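(* Let $(G,H)$ be a model geometry and let $(\mathcal{G},\omega)$ be a Cartan geometry of type $(G,H)$ over a smooth manifold $M$. Then for every $u\in\mathcal{G}$ the intrinsic holonomy group of $(\mathcal{G},\omega)$ at $u$ equals the extrinsic holonomy group at $(u,e)\in\widehat{\mathcal{G}}$: $$\mathrm{Hol}_u(\mathcal{G},\omega)=\mathrm{Hol}_{(u,e)}(\widehat{\mathcal{G}},\widehat{\omega})$$ as subgroups of $G$.
   Context: A model geometry $(G,H)$ is a Lie group $G$ with a closed subgroup $H$ such that $G/H$ is connected; $\mathfrak{g},\mathfrak{h}$ are the Lie algebras. A Cartan geometry $(\mathcal{G},\omega)$ of type $(G,H)$ over $M$ is a (right) principal $H$-bundle $q_H:\mathcal{G}\to M$ with a $\mathfrak{g}$-valued 1-form $\omega$ on $\mathcal{G}$ such that (i) $\omega_u:T_u\mathcal{G}\to\mathfrak{g}$ is a linear isomorphism for all $u$; (ii) $R_h^*\omega=\mathrm{Ad}_{h^{-1}}\omega$ for all $h\in H$; (iii) for $Y\in\mathfrak{h}$ the flow of the vector field $\omega^{-1}(Y)$ is $u\mapsto u\exp(tY)$. Paths are piecewise smooth. The development of a path $\gamma:[0,1]\to\mathcal{G}$ is the unique path $\gamma_G:[0,1]\to G$ with $\gamma_G(0)=e$ and $\gamma^*\omega=\gamma_G^*\omega_G$, where $\omega_G$ is the (left-invariant) Maurer–Cartan form of $G$. The intrinsic holonomy group at $u\in\mathcal{G}$ is $$\mathrm{Hol}_u(\mathcal{G},\omega)=\{\gamma_G(1)h\in G:\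 h\in H,\ \gamma:[0,1]\to\mathcal{G}\text{ a path with }\gamma(0)=u=\gamma(1)h\}.$$ The extended bundle is the principal $G$-bundle $\widehat{\mathcal{G}}=\mathcal{G}\times_H G$ (so $(uh,g')=(u,hg')$ for $h\in H$), and $\widehat{\omega}$ is the unique principal $G$-connection on $\widehat{\mathcal{G}}$ with $j^*\widehat{\omega}=\omega$, where $j:\mathcal{G}\to\widehat{\mathcal{G}}$, $u\mapsto(u,e)$. The extrinsic holonomy group at $\widehat{u}\in\widehat{\mathcal{G}}$ is the usual holonomy group $\mathrm{Hol}_{\widehat{u}}(\widehat{\mathcal{G}},\widehat{\omega})\leq G$ of the principal connection $\widehat\omega$ at $\widehat{u}$. *)

(* Defs.v *)
From HB Require Import structures.
From mathcomp Require Import all_boot all_order all_algebra.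
From mathcomp Require Import generic_quotient.
From mathcomp Require Import all_classical all_reals.
From mathcomp Require Import topology normedtype landau derive.

Set Implicit Arguments.
Unset Strict Implicit.
Unset Printing Implicit Defensive.

Import Order.TTheory GRing.Theory Num.Theory.
Import numFieldNormedType.Exports.

Local Open Scope classical_set_scope.
Local Open Scope ring_scope.

Section smooth.
Context {R : realType}.
Implicit Types V W X : normedModType R.

Fixpoint class_C {V W} (k : nat) (U : set V) (f : V -> W) : Prop :=
  if k is k'.+1 then
    (forall x, U x -> differentiable f x) /\
    (forall v, class_C k' U (fun x => 'd f x v))
  else forall x, U x -> {for x, continuous f}.

Definition smooth_on {V W} (U : set V) (f : V -> W) := forall k, class_C k U f.

Lemma class_C_sub V W k (U U' : set V) (f : V -> W) :
  U' `<=` U -> class_C k U f -> class_C k U' f.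
Proof.
move=> UU; elim: k f => [|k IH] f /=; first by move=> H x /UU; exact: H.
by move=> [H1 H2]; split=> [x /UU|v]; [exact: H1|exact: IH].
Qed.

Lemma is_diff_near V W (f g : V -> W) (x : V) :
  (\forall y \near x, f y = g y) -> differentiable f x ->
  differentiable g x /\ 'd g x = 'd f x :> (V -> W).
Proof.
move=> fg df.
have fgx : f x = g x := nbhs_singleton fg.
have fg0 : \forall y \near (0 : V), f (y + x) = g (y + x).
  by move: fg; rewrite (near_shift 0 x) subr0.
have key : g \o shift x = cst (g x) + 'd f x +o_ (0 : V) id.
  apply/eqaddoP => e e0.
  have /eqaddoP/(_ e e0) H := diff_locally df.
  near=> y.
  have E : f (y + x) = g (y + x) by near: y.
  have : `|(f \o shift x - (cst (f x) + 'd f x)) y| <= e * `|id y| by near: y.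
  by rewrite /= !fctE /= E fgx.
have dgE := diff_unique (diff_continuous df) key.
split=> //; apply/diff_locallyP; rewrite dgE; split=> //.
exact: diff_continuous.
Unshelve. all: by end_near. Qed.

Lemma class_C_ext V W k (U : set V) (f g : V -> W) : open U ->
  (forall x, U x -> f x = g x) -> class_C k U f -> class_C k U g.
Proof.
move=> oU; elim: k f g => [|k IH] f g fg /=.
  move=> H x Ux; rewrite /prop_for /continuous_at -(fg _ Ux).
  apply: cvg_trans (H x Ux); apply: near_eq_cvg.
  by apply: filterS (open_nbhs_nbhs (conj oU Ux)) => y /fg.
move=> [H1 H2].
have K x : U x -> differentiable g x /\ 'd g x = 'd f x :> (V -> W).
  move=> Ux; apply: is_diff_near (H1 _ Ux).
  by apply: filterS (open_nbhs_nbhs (conj oU Ux)) => y /fg.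
split=> [x /K[]//|v]; apply: IH (H2 v) => x /K[_ ->] //.
Qed.

Lemma class_C_comp_lin V W X k (U : set V) (f : V -> W) (L : {linear X -> V}) :
  continuous L -> open U -> class_C k U f ->
  class_C k (L @^-1` U) (f \o L).
Proof.
move=> cL oU; elim: k f => [|k IH] f /=.
  by move=> H x Ux; apply: continuous_comp; [exact: cL|exact: H].
move=> [H1 H2]; split=> [x Ux|v].
  apply: differentiable_comp; last exact: H1.
  exact: linear_differentiable.
apply: class_C_ext (IH _ (H2 (L v))); first by apply: open_comp => // y _; exact: cL.
move=> x Ux /=; rewrite (@diff_comp _ _ _ _ L f x) /=.
- by rewrite (@diff_lin _ _ _ L).
- exact: linear_differentiable.
- exact: H1.
Qed.

Lemma class_C_lin_comp V W X k (U : set V) (f : V -> W) (L : {linear W -> X}) :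
  continuous L -> open U -> class_C k U f -> class_C k U (L \o f).
Proof.
move=> cL oU; elim: k f => [|k IH] f /=.
  by move=> H x Ux; apply: continuous_comp; [exact: H|exact: cL].
move=> [H1 H2]; split=> [x Ux|v].
  apply: differentiable_comp; first exact: H1.
  exact: linear_differentiable.
apply: class_C_ext (IH _ (H2 v)) => // x Ux /=.
rewrite (@diff_comp _ _ _ _ f L x) /=.
- by rewrite (@diff_lin _ _ _ L).
- exact: H1.
- exact: linear_differentiable.
Qed.

Lemma class_CD V W k (U : set V) (f g : V -> W) : open U ->
  class_C k U f -> class_C k U g -> class_C k U (f + g).
Proof.
move=> oU; elim: k f g => [|k IH] f g /=.
  by move=> Hf Hg x Ux; apply: continuousD; [exact: Hf|exact: Hg].
move=> [f1 f2] [g1 g2]; split=> [x Ux|v].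
  by apply: differentiableD; [exact: f1|exact: g1].
apply: class_C_ext (IH _ _ (f2 v) (g2 v)) => // x Ux.
by rewrite diffD; [|exact: f1|exact: g1].
Qed.

End smooth.

Section manifold.
Variable R : realType.

Record chart (T : topologicalType) (n : nat) := Chart {
  chart_dom : set T;
  chart_fun :> T -> 'rV[R]_n;
  chart_inv : 'rV[R]_n -> T;
  chart_dom_open : open chart_dom;
  chart_cod_open : open (chart_fun @` chart_dom);
  chartK : forall x, chart_dom x -> chart_inv (chart_fun x) = x;
  chart_fun_cont : forall x, chart_dom x -> {for x, continuous chart_fun};
  chart_inv_cont : forall y, (chart_fun @` chart_dom) y ->
    {for y, continuous chart_inv} }.

Definition chart_cod T n (c : chart T n) : set 'rV[R]_n :=
  c @` chart_dom c.

Definition transition_dom T n (c d : chart T n) : set 'rV[R]_n :=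
  chart_cod c `&` (chart_inv c @^-1` chart_dom d).

(* [chart_at p] is a preferred chart around [p]; it only serves to represent
   the tangent space at [p], see [tangent]. *)
Record manifold := Manifold {
  carrier :> topologicalType;
  dim : nat;
  atlas : set (chart carrier dim);
  chart_at : carrier -> chart carrier dim;
  chart_at_atlas : forall p, atlas (chart_at p);
  chart_at_dom : forall p, chart_dom (chart_at p) p;
  atlas_compat : forall c d, atlas c -> atlas d ->
    smooth_on (transition_dom c d) (d \o chart_inv c);
  manifold_hausdorff : hausdorff_space carrier;
  manifold_countable : @second_countable carrier }.

Definition smooth_map_on (M N : manifold) (U : set M) (f : M -> N) :=
  (forall x, U x -> {for x, continuous f}) /\
  forall c d, atlas c -> atlas d ->
    smooth_on (chart_cod c `&`
               (chart_inv c @^-1` (U `&` f @^-1` chart_dom d)))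
              (d \o f \o chart_inv c).

Definition smooth_map (M N : manifold) (f : M -> N) := smooth_map_on setT f.

End manifold.

Section product.
Variable R : realType.

Lemma continuous_pair (S T U : topologicalType) (f : S -> T) (g : S -> U) x :
  {for x, continuous f} -> {for x, continuous g} ->
  {for x, continuous (fun y => (f y, g y))}.
Proof.
move=> cf cg; exact: (@cvg_pair _ _ _ (nbhs x) (nbhs (f x)) (nbhs (g x))
  (nbhs_filter _) (nbhs_filter _) (nbhs_filter _) f g cf cg).
Qed.

Lemma row_mx_continuous m n1 n2 :
  continuous (fun p : 'M[R]_(m, n1) * 'M[R]_(m, n2) => row_mx p.1 p.2).
Proof.
move=> [a b] A [P nP sPA].
have F := @nbhs_filter ('M[R]_(m, n1) * 'M[R]_(m, n2))%type (a, b).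
suff H : \forall p \near (a, b), forall i j, P i j (row_mx p.1 p.2 i j).
  by apply: filterS H => p Pp; exact: sPA.
suff H i j : \forall p \near (a, b), P i j (row_mx p.1 p.2 i j).
  apply: (@filter_forall _ _ (fun i p => forall j, P i j (row_mx p.1 p.2 i j))
    _ F) => i.
  exact: (@filter_forall _ _ (fun j p => P i j (row_mx p.1 p.2 i j)) _ F (H i)).
have := nP i j; rewrite mxE /=; case: splitP => k jk Pij.
  have : {for (a, b), continuous
      ((fun M : 'M[R]_(m, n1) => M i k) \o @fst _ 'M[R]_(m, n2))}.
    by apply: continuous_comp; [exact: cvg_fst|exact: coord_continuous].
  move=> /(_ _ Pij); apply: (@filterS _ _ F) => p /=; rewrite mxE.
  by case: splitP => k' jk'; rewrite jk in jk'; [rewrite (ord_inj jk')|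
    move: (ltn_ord k); rewrite jk' ltnNge leq_addr].
have : {for (a, b), continuous
    ((fun M : 'M[R]_(m, n2) => M i k) \o @snd 'M[R]_(m, n1) _)}.
  by apply: continuous_comp; [exact: cvg_snd|exact: coord_continuous].
move=> /(_ _ Pij); apply: (@filterS _ _ F) => p /=; rewrite mxE.
case: splitP => k' jk'; rewrite jk in jk'.
  by move: (ltn_ord k'); rewrite -jk' ltnNge leq_addr.
by move/addnI: jk' => /ord_inj ->.
Qed.

Definition row_mx_l n1 n2 (x : 'rV[R]_n1) : 'rV[R]_(n1 + n2) := row_mx x 0.
Definition row_mx_r n1 n2 (y : 'rV[R]_n2) : 'rV[R]_(n1 + n2) := row_mx 0 y.

Fact row_mx_l_linear n1 n2 : linear (@row_mx_l n1 n2).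
Proof.
by move=> a x y; rewrite /row_mx_l scale_row_mx add_row_mx scaler0 addr0.
Qed.
Fact row_mx_r_linear n1 n2 : linear (@row_mx_r n1 n2).
Proof.
by move=> a x y; rewrite /row_mx_r scale_row_mx add_row_mx scaler0 addr0.
Qed.
HB.instance Definition _ n1 n2 := GRing.isLinear.Build R _ _ _
  (@row_mx_l n1 n2) (@row_mx_l_linear n1 n2).
HB.instance Definition _ n1 n2 := GRing.isLinear.Build R _ _ _
  (@row_mx_r n1 n2) (@row_mx_r_linear n1 n2).

Lemma row_mx_l_continuous n1 n2 : continuous (@row_mx_l n1 n2).
Proof.
move=> x.
have H : {for x, continuous (fun x : 'rV[R]_n1 => (x, 0 : 'rV[R]_n2))}.
  by apply: continuous_pair; [|exact: cst_continuous].
exact: (continuous_comp H (@row_mx_continuous 1 n1 n2 _)).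
Qed.

Lemma row_mx_r_continuous n1 n2 : continuous (@row_mx_r n1 n2).
Proof.
move=> x.
have H : {for x, continuous (fun x : 'rV[R]_n2 => (0 : 'rV[R]_n1, x))}.
  by apply: continuous_pair; [exact: cst_continuous|].
exact: (continuous_comp H (@row_mx_continuous 1 n1 n2 _)).
Qed.

Lemma smooth_on_row_mx m1 m2 n1 n2 (U : set 'rV[R]_m1) (V : set 'rV[R]_m2)
    (f : 'rV[R]_m1 -> 'rV[R]_n1) (g : 'rV[R]_m2 -> 'rV[R]_n2) :
  open U -> open V -> smooth_on U f -> smooth_on V g ->
  smooth_on ((lsubmx @^-1` U) `&` (rsubmx @^-1` V))
    (fun z : 'rV[R]_(m1 + m2) => row_mx (f (lsubmx z)) (g (rsubmx z))).
Proof.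
move=> oU oV sf sg k.
have oU' : open ((lsubmx : 'rV[R]_(m1 + m2) -> _) @^-1` U).
  by apply: open_comp => // ? _; exact: continuous_lsubmx.
have oV' : open ((rsubmx : 'rV[R]_(m1 + m2) -> _) @^-1` V).
  by apply: open_comp => // ? _; exact: continuous_rsubmx.
have -> : (fun z : 'rV[R]_(m1 + m2) => row_mx (f (lsubmx z)) (g (rsubmx z))) =
    (@row_mx_l n1 n2 \o (f \o lsubmx)) + (@row_mx_r n1 n2 \o (g \o rsubmx)).
  apply/funext => z /=; rewrite fctE /=.
  by rewrite /row_mx_l /row_mx_r add_row_mx addr0 add0r.
apply: class_CD; first exact: openI.
- apply: (class_C_lin_comp (L := @row_mx_l n1 n2)).
  + exact: row_mx_l_continuous.
  + exact: openI.
  apply: class_C_sub (@subIsetl _ _ _) _.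
  apply: (class_C_comp_lin (L := @lsubmx R 1 m1 m2)) => //.
  exact: continuous_lsubmx.
- apply: (class_C_lin_comp (L := @row_mx_r n1 n2)).
  + exact: row_mx_r_continuous.
  + exact: openI.
  apply: class_C_sub (@subIsetr _ _ _) _.
  apply: (class_C_comp_lin (L := @rsubmx R 1 m1 m2)) => //.
  exact: continuous_rsubmx.
Qed.

Section prod_chart.
Variables (S T : topologicalType) (m n : nat).
Variables (c : chart R S m) (d : chart R T n).

Let dom : set (S * T) := chart_dom c `*` chart_dom d.
Let to (p : S * T) : 'rV[R]_(m + n) := row_mx (c p.1) (d p.2).
Let of_ (z : 'rV[R]_(m + n)) : S * T :=
  (chart_inv c (lsubmx z), chart_inv d (rsubmx z)).

Let prod_cod :
  to @` dom = (lsubmx @^-1` chart_cod c) `&` (rsubmx @^-1` chart_cod d).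
Proof.
apply/seteqP; split => [_ [[x y] [/= cx dy] <-]|z [[x cx xE] [y dy yE]]].
  by split; rewrite /= /to ?row_mxKl ?row_mxKr; [exists x|exists y].
by exists (x, y) => //; rewrite /to /= xE yE hsubmxK.
Qed.

Let dom_open : open dom.
Proof.
have -> : dom = (fst @^-1` chart_dom c) `&` (snd @^-1` chart_dom d).
  by apply/seteqP; split => -[x y].
apply: openI; apply: open_comp.
- by move=> ? _; exact: cvg_fst.
- exact: chart_dom_open.
- by move=> ? _; exact: cvg_snd.
- exact: chart_dom_open.
Qed.

Let cod_open : open (to @` dom).
Proof.
rewrite prod_cod; apply: openI; apply: open_comp.
- by move=> ? _; exact: continuous_lsubmx.
- exact: chart_cod_open.
- by move=> ? _; exact: continuous_rsubmx.
- exact: chart_cod_open.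
Qed.

Let toK x : dom x -> of_ (to x) = x.
Proof.
by case: x => x y [/= cx dy]; rewrite /of_ /to row_mxKl row_mxKr !chartK.
Qed.

Let to_cont x : dom x -> {for x, continuous to}.
Proof.
case: x => x y [/= cx dy].
apply: (@continuous_comp _ _ _ (fun p : S * T => (c p.1, d p.2))
  (fun p => row_mx p.1 p.2)); last exact: row_mx_continuous.
apply: continuous_pair.
  apply: (@continuous_comp _ _ _ fst c); first exact: cvg_fst.
  exact: chart_fun_cont.
apply: (@continuous_comp _ _ _ snd d); first exact: cvg_snd.
exact: chart_fun_cont.
Qed.

Let of_cont z : (to @` dom) z -> {for z, continuous of_}.
Proof.
rewrite prod_cod => -[cz dz]; apply: continuous_pair.
  apply: (@continuous_comp _ _ _ lsubmx (chart_inv c)).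
    exact: continuous_lsubmx.
  exact: chart_inv_cont.
apply: (@continuous_comp _ _ _ rsubmx (chart_inv d)).
  exact: continuous_rsubmx.
exact: chart_inv_cont.
Qed.

Definition prod_chart : chart R (S * T)%type (m + n)%N :=
  @Chart R (S * T)%type (m + n)%N dom to of_ dom_open cod_open toK to_cont of_cont.

Lemma chart_cod_prod : chart_cod prod_chart =
  (lsubmx @^-1` chart_cod c) `&` (rsubmx @^-1` chart_cod d).
Proof. exact: prod_cod. Qed.

End prod_chart.

Lemma transition_dom_open (T : topologicalType) n (c d : chart R T n) :
  open (transition_dom c d).
Proof.
rewrite openE => z [cz dz]; rewrite /interior.
have nc : nbhs z (chart_cod c).
  by apply: open_nbhs_nbhs; split => //; exact: chart_cod_open.
have nd : nbhs (chart_inv c z) (chart_dom d).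
  by apply: open_nbhs_nbhs; split => //; exact: chart_dom_open.
exact: (@filterI _ _ (nbhs_filter z) _ _ nc (chart_inv_cont cz nd)).
Qed.

Lemma second_countable_prod (S T : topologicalType) :
  @second_countable S -> @second_countable T ->
  @second_countable (S * T)%type.
Proof.
move=> [A cA [oA bA]] [B cB [oB bB]].
exists ((fun p : set S * set T => p.1 `*` p.2) @` (A `*` B)).
  by apply: sub_countable (countableX cA cB); exact: card_image_le.
split=> [_ [[U V] [/= AU BV] <-]|[x y] W [[P Q] [/= nP nQ] PQW]].
  have -> : U `*` V = (fst @^-1` U) `&` (snd @^-1` V).
    by apply/seteqP; split => -[].
  apply: openI; apply: open_comp.
  - by move=> ? _; exact: cvg_fst.
  - exact: oA.
  - by move=> ? _; exact: cvg_snd.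
  - exact: oB.
have [U [AU Ux] UP] := bA _ _ nP; have [V [BV Vy] VQ] := bB _ _ nQ.
exists (U `*` V); last by move=> [a b] [/= Ua Vb]; apply: PQW; split; [exact: UP|exact: VQ].
by split=> //; exists (U, V).
Qed.

Lemma hausdorff_prod (S T : topologicalType) :
  hausdorff_space S -> hausdorff_space T -> hausdorff_space (S * T)%type.
Proof.
move=> hS hT [x y] [x' y'] cl; congr pair.
- apply: hS => A B Ax Bx'.
  have [||[a b] [/= Aa Ba]] := cl (fst @^-1` A) (fst @^-1` B).
  + exact: (@cvg_fst _ _ _ _ (@nbhs_filter T y) A).
  + exact: (@cvg_fst _ _ _ _ (@nbhs_filter T y') B).
  by exists a.
- apply: hT => A B Ay By'.
  have [||[a b] [/= Aa Ba]] := cl (snd @^-1` A) (snd @^-1` B).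
  + exact: (@cvg_snd _ _ _ _ (@nbhs_filter S x) A).
  + exact: (@cvg_snd _ _ _ _ (@nbhs_filter S x') B).
  by exists b.
Qed.

Variables M N : manifold R.

Let prod_atlas : set (chart R (M * N)%type (dim M + dim N)%N) :=
  [set e | exists c d, [/\ @atlas _ M c, @atlas _ N d & e = prod_chart c d]].

Let prod_chart_at (p : M * N) := prod_chart (chart_at p.1) (chart_at p.2).

Let prod_chart_at_atlas p : prod_atlas (prod_chart_at p).
Proof.
by exists (chart_at p.1), (chart_at p.2); split => //; exact: chart_at_atlas.
Qed.

Let prod_chart_at_dom p : chart_dom (prod_chart_at p) p.
Proof. by split; exact: chart_at_dom. Qed.

Let prod_compat c d : prod_atlas c -> prod_atlas d ->
  smooth_on (transition_dom c d) (d \o chart_inv c).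
Proof.
move=> [c1 [c2 [a1 a2 ->]]] [d1 [d2 [b1 b2 ->]]] k.
have H := smooth_on_row_mx (transition_dom_open (c := c1) (d := d1))
  (transition_dom_open (c := c2) (d := d2))
  (atlas_compat a1 b1) (atlas_compat a2 b2).
apply: class_C_sub (H k) => z [].
by rewrite chart_cod_prod => -[? ?] [? ?].
Qed.

Definition prod_manifold : manifold R :=
  @Manifold R (M * N)%type (dim M + dim N)%N prod_atlas prod_chart_at
    prod_chart_at_atlas prod_chart_at_dom prod_compat
    (hausdorff_prod (@manifold_hausdorff _ M) (@manifold_hausdorff _ N))
    (second_countable_prod (@manifold_countable _ M) (@manifold_countable _ N)).

End product.

Section tangent.
Variable R : realType.
Implicit Types M N : manifold R.

(* A tangent vector at [p] is represented by its coordinates in the chart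
   [chart_at p]; the vector with coordinates [v] in another chart [c] around
   [p] is ['d (chart_at p \o chart_inv c) (c p) v]. Points that are provably
   equal have the same chart, so no transport is needed between their tangent
   spaces, which are all convertible to ['rV[R]_(dim M)]. *)
Definition tangent M (p : M) : Type := 'rV[R]_(dim M).
HB.instance Definition _ M (p : M) := NormedModule.on (tangent p).

Definition dmap M N (f : M -> N) (p : M) (v : tangent p) : tangent (f p) :=
  'd (chart_at (f p) \o f \o chart_inv (chart_at p)) (chart_at p p) v.
Arguments dmap {M N} f p v.

Definition one_form M (W : normedModType R) := forall p : M, tangent p -> W.

(* Smoothness of the coefficients of [w] in each chart of the atlas. *)
Definition smooth_form M (W : normedModType R) (w : one_form M W) :=
  (forall p, linear (w p)) /\
  forall (c : chart R M (dim M)) (v : 'rV[R]_(dim M)), atlas c ->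
    smooth_on (chart_cod c)
      (fun x => let p := chart_inv c x in
                w p ('d (chart_at p \o chart_inv c) x v)).

Definition pullback_form M N W (f : M -> N) (w : one_form N W) :
  one_form M W := fun p v => w (f p) (dmap f p v).

Definition has_velocity M (gamma : R -> M) (t : R) (v : tangent (gamma t)) :=
  {for t, continuous gamma} /\
  is_derive t 1 (chart_at (gamma t) \o gamma) (v : 'rV[R]_(dim M)).

Definition smooth_curve_on M (I : set R) (gamma : R -> M) :=
  (forall t, I t -> {for t, continuous gamma}) /\
  forall c : chart R M (dim M), atlas c ->
    smooth_on (I `&` gamma @^-1` chart_dom c) (c \o gamma).

(* Only the values of [gamma] on [a, b] matter; the arcs are smooth up to
   their end points. *)
Inductive piecewise_smooth M (gamma : R -> M) : R -> R -> Prop :=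
| piecewise_smooth_arc a b (I : set R) (delta : R -> M) of
    a < b & open I & smooth_curve_on I delta &
    (forall t, a <= t <= b -> I t /\ gamma t = delta t) :
    piecewise_smooth gamma a b
| piecewise_smooth_cat a b c of
    piecewise_smooth gamma a b & piecewise_smooth gamma b c :
    piecewise_smooth gamma a c.

Definition is_path M (gamma : R -> M) := piecewise_smooth gamma 0 1.

(* [gamma^* w = delta^* eta] for two piecewise smooth paths on [0, 1]: the
   identity is required at the times at which both are differentiable, that is,
   at all but finitely many times. *)
Definition eq_pullback_path M N W (gamma : R -> M) (w : one_form M W)
    (delta : R -> N) (eta : one_form N W) :=
  forall (t : R) (v : tangent (gamma t)) (v' : tangent (delta t)),
    0 < t < 1 -> has_velocity v -> has_velocity v' ->
    w (gamma t) v = eta (delta t) v'.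

End tangent.
Arguments dmap {R M N} f p v.
Arguments pullback_form {R M N W} f w p v.

Section lie_group.
Variable R : realType.

Record lie_group := LieGroup {
  lie_manifold :> manifold R;
  lie_mul : lie_manifold -> lie_manifold -> lie_manifold;
  lie_inv : lie_manifold -> lie_manifold;
  lie_one : lie_manifold;
  lie_mulA : associative lie_mul;
  lie_mul1 : left_id lie_one lie_mul;
  lie_mulr1 : right_id lie_one lie_mul;
  lie_mulV : left_inverse lie_one lie_inv lie_mul;
  lie_mulrV : right_inverse lie_one lie_inv lie_mul;
  lie_mul_smooth : smooth_map (M := prod_manifold lie_manifold lie_manifold)
    (fun p => lie_mul p.1 p.2);
  lie_inv_smooth : smooth_map lie_inv }.

Variable G : lie_group.

(* The vector space underlying the Lie algebra. *)
Definition lie_algebra := tangent (lie_one G).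
HB.instance Definition _ := NormedModule.on lie_algebra.

Definition maurer_cartan : one_form G lie_algebra :=
  fun g v => dmap (lie_mul (lie_inv g)) g v.

Definition lie_Ad (g : G) (X : lie_algebra) : lie_algebra :=
  dmap (fun x => lie_mul (lie_mul g x) (lie_inv g)) (lie_one G) X.

Definition one_parameter_subgroup (sigma : R -> G) :=
  smooth_curve_on setT sigma /\
  forall s t, sigma (s + t) = lie_mul (sigma s) (sigma t).

Definition lie_exp (X : lie_algebra) : G :=
  xget (fun=> lie_one G) [set sigma : R -> G |
    one_parameter_subgroup sigma /\ has_velocity (t := 0) (X : tangent (sigma 0))] 1.

End lie_group.
Arguments maurer_cartan {R} G p v : rename.

Section model_geometry.
Variable R : realType.

(* A closed subgroup of [G], as the image of a Lie group under a closed
   embedding: the Lie group structure of a closed subgroup is unique. *)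
Record closed_subgroup (G : lie_group R) := ClosedSubgroup {
  sub_group :> lie_group R;
  sub_incl : sub_group -> G;
  sub_inclM : forall h k, sub_incl (lie_mul h k) =
                          lie_mul (sub_incl h) (sub_incl k);
  sub_incl_inj : injective sub_incl;
  sub_incl_smooth : smooth_map sub_incl;
  sub_incl_immersion : forall h, injective (dmap sub_incl h);
  sub_incl_embedding : forall A : set sub_group, open A ->
    exists2 B : set G, open B & A = sub_incl @^-1` B;
  sub_incl_closed : closed (range sub_incl) }.

Section cosets.
Variables (G : lie_group R) (H : closed_subgroup G).

Definition coset_rel (g g' : G) : bool :=
  `[< exists h : H, g' = lie_mul g (sub_incl h) >].

Lemma sub_incl1 : sub_incl (lie_one H) = lie_one G.
Proof.
have := sub_inclM (lie_one H) (lie_one H); rewrite lie_mul1.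
move=> /(congr1 (lie_mul (lie_inv (sub_incl (lie_one H))))).
by rewrite lie_mulA lie_mulV lie_mul1.
Qed.

Lemma coset_rel_equiv : equiv_class_of coset_rel.
Proof.
split=> [g|g g'|g' g g''].
- by apply/asboolP; exists (lie_one H); rewrite sub_incl1 lie_mulr1.
- wlog suff S : g g' / coset_rel g g' -> coset_rel g' g.
    by apply/idP/idP; exact: S.
  move=> /asboolP[h ->]; apply/asboolP; exists (lie_inv h).
  by rewrite -lie_mulA -sub_inclM lie_mulrV sub_incl1 lie_mulr1.
- move=> /asboolP[h ->] /asboolP[k ->]; apply/asboolP; exists (lie_mul h k).
  by rewrite sub_inclM lie_mulA.
Qed.

Canonical coset_equiv := EquivRelPack coset_rel_equiv.

Definition homogeneous_space := quotient_topology {eq_quot coset_equiv}%qT.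

End cosets.

Record model_geometry := ModelGeometry {
  model_group : lie_group R;
  model_sub : closed_subgroup model_group;
  model_connected : connected [set: homogeneous_space model_sub] }.

End model_geometry.

Section principal_bundle.
Variable R : realType.

(* [phi] is an equivariant diffeomorphism from [q @^-1` U] onto [U `*` setT],
   over [U], with inverse [psi]. *)
Definition local_trivialization (H : lie_group R) (M P : manifold R)
    (q : P -> M) (act : P -> H -> P) (U : set M)
    (phi : P -> prod_manifold M H) (psi : prod_manifold M H -> P) :=
  [/\ open U,
      smooth_map_on (q @^-1` U) phi /\
      smooth_map_on (M := prod_manifold M H) (U `*` setT) psi,
      forall u, U (q u) -> (phi u).1 = q u /\ psi (phi u) = u,
      forall z, U z.1 -> q (psi z) = z.1 /\ phi (psi z) = z
    & forall u h, U (q u) ->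
        phi (act u h) = ((phi u).1, lie_mul (phi u).2 h)].

Record principal_bundle (H : lie_group R) (M : manifold R) := PrincipalBundle {
  pb_total :> manifold R;
  pb_proj : pb_total -> M;
  pb_act : pb_total -> H -> pb_total;
  pb_act1 : forall u, pb_act u (lie_one H) = u;
  pb_actM : forall u h k, pb_act u (lie_mul h k) = pb_act (pb_act u h) k;
  pb_proj_act : forall u h, pb_proj (pb_act u h) = pb_proj u;
  pb_proj_smooth : smooth_map pb_proj;
  pb_act_smooth : smooth_map (M := prod_manifold pb_total H)
    (fun z => pb_act z.1 z.2);
  pb_trivial : forall x : M, exists U phi psi,
    U x /\ local_trivialization pb_proj pb_act U phi psi }.

Definition principal_connection (G : lie_group R) (M : manifold R)
    (P : principal_bundle G M) (theta : one_form P (lie_algebra G)) :=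
  [/\ smooth_form theta,
      forall g u v, pullback_form (fun u' => pb_act u' g) theta u v =
                    lie_Ad (lie_inv g) (theta u v)
    & forall u (Y : lie_algebra G), theta _ (dmap (pb_act u) (lie_one G) Y) = Y].

Definition holonomy (G : lie_group R) (M : manifold R)
    (P : principal_bundle G M) (theta : one_form P (lie_algebra G)) (u : P) :
    set G :=
  [set g | exists gamma : R -> P,
    [/\ is_path gamma, gamma 0 = u, gamma 1 = pb_act u g
      & forall (t : R) (v : tangent (gamma t)),
          0 < t < 1 -> has_velocity v -> theta (gamma t) v = 0]].

(* The associated bundle [P *_H G]: its points are the classes of pairs for the
   relation [(u h, g) ~ (u, h g)], [G] acts by [(u, g) g' = (u, g g')], and its
   smooth structure is the one for which every local trivialization [(phi, psi)]
   of [P] induces a local trivialization whose inverse is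
   [(x, g) |-> (psi (x, 1), g)]. These properties determine it up to a unique
   isomorphism compatible with [ext_class]. *)
Record extended_bundle (G : lie_group R) (H : closed_subgroup G)
    (M : manifold R) (P : principal_bundle H M) := ExtendedBundle {
  ext_bundle :> principal_bundle G M;
  ext_class : P -> G -> ext_bundle;
  ext_class_surj : forall z, exists u g, z = ext_class u g;
  ext_class_eq : forall u g u' g', ext_class u g = ext_class u' g' <->
    exists h : H, u' = pb_act u h /\ g = lie_mul (sub_incl h) g';
  ext_proj : forall u g, pb_proj (ext_class u g) = pb_proj u;
  ext_act : forall u g g',
    pb_act (ext_class u g) g' = ext_class u (lie_mul g g');
  ext_trivial : forall U phi psi,
    local_trivialization (@pb_proj _ _ P) (@pb_act _ _ P) U phi psi ->
    exists phi', local_trivialization (@pb_proj _ _ ext_bundle)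
      (@pb_act _ _ ext_bundle) U phi'
      (fun z => ext_class (psi (z.1, lie_one H)) z.2) }.

Definition ext_incl (G : lie_group R) (H : closed_subgroup G)
    (M : manifold R) (P : principal_bundle H M) (E : extended_bundle P)
    (u : P) : E := ext_class E u (lie_one G).

End principal_bundle.

Section cartan_geometry.
Variable R : realType.

(* The last condition says that [u |-> u exp (t Y)] is the flow of the vector
   field [w^-1 Y], for [Y] in the Lie algebra of [H]. *)
Definition cartan_connection (G : lie_group R) (H : closed_subgroup G)
    (M : manifold R) (P : principal_bundle H M)
    (w : one_form P (lie_algebra G)) :=
  [/\ smooth_form w,
      forall u, bijective (w u),
      forall (h : H) u v, pullback_form (fun u' => pb_act u' h) w u v =
                          lie_Ad (lie_inv (sub_incl h)) (w u v)
    & forall (Y : lie_algebra H) (u : P) (t : R),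
        exists v : tangent (pb_act u (lie_exp (t *: Y))),
          has_velocity (gamma := fun s => pb_act u (lie_exp (s *: Y)))
            (t := t) v /\
          w _ v = dmap (@sub_incl _ _ H) (lie_one H) Y].

Record cartan_geometry (K : model_geometry R) (M : manifold R) :=
  CartanGeometry {
  cartan_bundle :> principal_bundle (model_sub K) M;
  cartan_form : one_form cartan_bundle (lie_algebra (model_group K));
  cartan_formP : cartan_connection cartan_form }.

Arguments cartan_form {K M} c p v : rename.

Variables (K : model_geometry R) (M : manifold R).

Definition development (C : cartan_geometry K M) (gamma : R -> C)
    (gammaG : R -> model_group K) :=
  [/\ is_path gammaG, gammaG 0 = lie_one (model_group K)
    & eq_pullback_path gamma (cartan_form C)
        gammaG (maurer_cartan (model_group K))].

Definition intrinsic_holonomy (C : cartan_geometry K M) (u : C) :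
    set (model_group K) :=
  [set g | exists (gamma : R -> C) (gammaG : R -> model_group K)
             (h : model_sub K),
    [/\ is_path gamma, gamma 0 = u, u = pb_act (gamma 1) h,
        development gamma gammaG & g = lie_mul (gammaG 1) (sub_incl h)]].

End cartan_geometry.
Arguments cartan_form {R K M} c p v : rename.

(* Main.v *)
From HB Require Import structures.
From mathcomp Require Import all_boot all_order all_algebra.
From mathcomp Require Import all_classical all_reals.
From mathcomp Require Import topology normedtype landau derive.
From mathcomp Require Import lra.
Require Import Defs.

Set Implicit Arguments.
Unset Strict Implicit.
Unset Printing Implicit Defensive.

Import Order.TTheory GRing.Theory Num.Theory.
Import numFieldNormedType.Exports.

Local Open Scope classical_set_scope.
Local Open Scope ring_scope.

(** Let [j] be the inclusion of the Cartan bundle in the extended bundle, and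
    consider curves [d] in the Cartan bundle, [g] in the group [G], and [c] in
    the extended bundle such that [j (d s) = c(s) g(s)]. The product rule for a
    principal connection ([connection_leibniz]) gives
      [omega (d') = Ad (g^-1) (theta (c')) + omega_G (g')],
    because [theta] pulls back to [omega] under [j]
    ([cartan_form_factor]). As [Ad] is injective, [c] is horizontal if and only
    if [d] and [g] have the same form, which says, when [g(0) = 1], that
    [g] is the development of [d]. Thus developments of paths and horizontal
    paths are the same thing, seen through [c = j(d) g^-1].

    From an element [g(1) h] of the intrinsic holonomy one gets the horizontal
    path [c = j(d) g^-1], which ends at [j(u) (g(1) h)^-1]
    ([intrinsic_sub_holonomy]). Conversely a horizontal path [c] has to be
    factored as [j(d) g^-1] with [d] and [g] piecewise smooth
    ([factorizable_piecewise_smooth]): this is clear over a trivializing open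
    set, and the local factorizations are chained along the path with the help
    of right translations by [H] ([holonomy_sub_intrinsic]). Both arguments produce
    inverses, and reversing paths shows that extrinsic holonomy is stable under
    inverses ([holonomy_inv]).

    Developments are compared at times of differentiability, and so is
    horizontality tested. A break point of [d] and of [g] can be a point where
    [c] has a velocity; that velocity is the one of the smooth arc of [c] to the
    right of the point, and the form takes on it, by continuity
    ([form_along_curve]), the value zero that it takes just after. *)

(** * Calculus of maps of class C^k *)

Section class_C_calculus.
Context {R : realType}.
Implicit Types V W X : normedModType R.

(** The differential at a point does not refer to the domain, so [class_C k U]
    is a pointwise condition; this is what lets every later smoothness claim be
    checked in one suitable chart near each point. *)
Lemma class_C_pointwise V W k (U : set V) (f : V -> W) :
  (forall x, U x -> class_C k [set x] f) -> class_C k U f.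
Proof.
elim: k f => [|k IH] f H /=; first by move=> x /H; apply.
split=> [x /H[+ _]|v]; first exact.
by apply: IH => x /H[_]; apply.
Qed.

Lemma class_C_local V W k (U : set V) (f : V -> W) :
  (forall x, U x -> exists2 J, J x & class_C k J f) -> class_C k U f.
Proof.
move=> H; apply: class_C_pointwise => x /H[J Jx].
by apply: class_C_sub => _ ->.
Qed.

Lemma class_C_pred V W k (U : set V) (f : V -> W) :
  class_C k.+1 U f -> class_C k U f.
Proof.
elim: k f => [|k IH] f [H1 H2] /=.
  by move=> x /H1 /differentiable_continuous.
by split=> // v; apply: IH; exact: H2.
Qed.

Lemma class_C_cst V W k (U : set V) (a : W) : class_C k U (fun=> a : W).
Proof.
elim: k a => [|k IH] a /=; first by move=> x _; exact: cst_continuous.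
split=> [x _|v]; first exact: differentiable_cst.
by under eq_fun do rewrite (diff_cst a) /=; exact: IH.
Qed.

Lemma class_C_sum V W k n (U : set V) (F : 'I_n -> V -> W) : open U ->
  (forall i, class_C k U (F i)) -> class_C k U (fun x => \sum_i F i x).
Proof.
move=> oU HF; have -> : (fun x => \sum_i F i x) = \sum_i F i.
  by apply/funext => x; rewrite fct_sumE.
elim/big_ind: _ => //; first exact: class_C_cst.
by move=> f g; exact: class_CD.
Qed.

Fact scale_bilinear W : bilinear_for
    (GRing.Scale.Law.clone _ _ *:%R _) (GRing.Scale.Law.clone _ _ *:%R _)
    (@GRing.scale R W).
Proof.
split=> [u'|u] a x y /=; first by rewrite scalerDl scalerA.
by rewrite scalerDr !scalerA mulrC.
Qed.
HB.instance Definition _ W := bilinear_isBilinear.Build R R W W _ _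
  (@GRing.scale R W) (@scale_bilinear W).

Lemma is_diff_scale V W (a : V -> R) (b : V -> W) x :
  differentiable a x -> differentiable b x ->
  is_diff x (fun y => a y *: b y) (fun v => a x *: 'd b x v + 'd a x v *: b x).
Proof.
move=> da db.
have sc : continuous (fun p : R * W => p.1 *: p.2).
  by move=> p; exact: scale_continuous.
have -> : (fun y => a y *: b y) =
  (fun p : R * W => p.1 *: p.2) \o (fun y => (a y, b y)) by [].
have dp := differentiable_pair da db.
have ds : differentiable (fun p : R * W => p.1 *: p.2) (a x, b x).
  exact: (@differentiable_bilin _ _ _ _ (@GRing.scale R W)).
apply: DiffDef; first exact: differentiable_comp.
rewrite diff_comp // (@diff_bilin _ _ _ _ (@GRing.scale R W)) //.
by apply/funext => v /=; rewrite diff_pair.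
Qed.

(** Leibniz rule, by induction on [k]: each term of the differential of the
    product pairs a factor of class C^k+1 with a derivative of class C^k. *)
Lemma class_C_scale V W k (U : set V) (a : V -> R) (b : V -> W) : open U ->
  class_C k U a -> class_C k U b -> class_C k U (fun x => a x *: b x).
Proof.
move=> oU; elim: k a b => [|k IH] a b Ha Hb.
  move=> x Ux; apply: (@continuous_comp _ _ _ (fun y => (a y, b y))
    (fun p : R * W => p.1 *: p.2)); last exact: scale_continuous.
  by apply: continuous_pair; [exact: Ha|exact: Hb].
have [Ha1 Ha2] := Ha; have [Hb1 Hb2] := Hb.
split=> [x Ux|v].
  by have [] := is_diff_scale (Ha1 _ Ux) (Hb1 _ Ux).
apply: (@class_C_ext _ _ _ _ _
  ((fun x => a x *: 'd b x v) + (fun x => 'd a x v *: b x))) => //.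
  move=> x Ux; have [_ ->] := is_diff_scale (Ha1 _ Ux) (Hb1 _ Ux).
  by rewrite fctE.
apply: class_CD => //; apply: IH; [|exact: Hb2|exact: Ha2|];
  exact: class_C_pred.
Qed.

Definition row_entry n (j : 'I_n) (A : 'rV[R]_n) : R := A 0 j.

Fact row_entry_linear n (j : 'I_n) : linear (row_entry j).
Proof. by move=> a A B; rewrite /row_entry !mxE. Qed.
HB.instance Definition _ n (j : 'I_n) := GRing.isLinear.Build R _ _ _
  (row_entry j) (row_entry_linear j).

(** By the chain rule, the differential of [g \o f] in the direction [v] is the
    combination of the partial derivatives of [g], taken along [f], with the
    coordinates of ['d f x v] as coefficients. The induction then applies to the
    partial derivatives; finite dimension of the middle space is what makes this
    a finite sum. *)
Lemma class_C_comp X W k n (I : set X) (U : set 'rV[R]_n)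
    (f : X -> 'rV[R]_n) (g : 'rV[R]_n -> W) : open I ->
  (forall x, I x -> U (f x)) -> class_C k I f -> class_C k U g ->
  class_C k I (g \o f).
Proof.
move=> oI fIU; elim: k g => [|k IH] g Hf Hg.
  move=> x Ix; apply: continuous_comp; first exact: Hf.
  by apply: Hg; exact: fIU.
have [f1 f2] := Hf; have [g1 g2] := Hg.
split=> [x Ix|v].
  by apply: differentiable_comp; [exact: f1|apply: g1; exact: fIU].
apply: (@class_C_ext _ _ _ _ _ (fun x =>
  \sum_j ('d f x v 0 j) *: 'd g (f x) (delta_mx 0 j))) => //.
  move=> x Ix; rewrite (@diff_comp _ _ _ _ f g x); last 2 first.
  - exact: f1.
  - by apply: g1; exact: fIU.
  rewrite /= [in RHS](row_sum_delta ('d f x v)) linear_sum.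
  by apply: eq_bigr => j _; rewrite linearZ.
apply: class_C_sum => // j; apply: class_C_scale => //.
  apply: (class_C_lin_comp (L := row_entry j)) => //.
    exact: coord_continuous.
  exact: f2.
by apply: (IH (fun y => 'd g y (delta_mx 0 j)));
  [exact: class_C_pred|exact: g2].
Qed.

Lemma class_C_reflect W k (a : R) (U : set R) (f : R -> W) :
  open U -> class_C k U f -> class_C k [set x | U (a - x)] (fun x => f (a - x)).
Proof.
have dr (x : R) : is_diff x (fun x : R => a - x) -%R.
  have -> : (fun x : R => a - x) = cst a - id by [].
  by apply: is_diff_eq; apply/funext => y /=; rewrite !fctE sub0r.
have cr (x : R) : {for x, continuous (fun x : R => a - x)}.
  by apply/differentiable_continuous; have [] := dr x.
move=> oU; have oU' : open [set x | U (a - x)].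
  by apply: (open_comp (f := fun x : R => a - x)) => // x _; exact: cr.
elim: k f => [|k IH] f.
  move=> Hf x /= Ux; apply: (@continuous_comp _ _ _ (fun x : R => a - x) f).
    exact: cr.
  exact: Hf.
move=> [f1 f2]; split=> [x /= Ux|v].
  apply: (@differentiable_comp _ _ _ _ (fun x : R => a - x) f).
    by have [] := dr x.
  exact: f1.
apply: (class_C_ext oU' _ (IH _ (f2 (- v)))) => x Ux.
have [dx dxE] := dr x.
have E := diff_comp dx (f1 _ Ux).
transitivity (('d f (a - x) \o 'd (fun x : R => a - x) x) v).
  by rewrite /= dxE.
by rewrite -E.
Qed.

End class_C_calculus.

(** * Smooth maps from a normed space to a manifold *)

Section smooth_param.
Context {R : realType}.
Implicit Types M N : manifold R.
Implicit Types X : normedModType R.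

Lemma open_preimage_on (S T : topologicalType) (I : set S) (f : S -> T)
    (A : set T) : open I -> (forall x, I x -> {for x, continuous f}) ->
  open A -> open (I `&` f @^-1` A).
Proof.
move=> oI cf oA; rewrite openE => x [Ix Ax]; rewrite /interior.
apply: (@filterI _ _ (nbhs_filter x)); first exact: open_nbhs_nbhs.
by apply: (cf _ Ix); exact: open_nbhs_nbhs.
Qed.

(** The common generalization of [smooth_curve_on] (for [X := R]) and of the
    inverses of charts (for [X] a coordinate space). With it, the smoothness of
    a map can be tested by composing with the inverse of a chart, by the same
    lemmas that serve for curves. *)
Definition smooth_param X M (I : set X) (g : X -> M) :=
  (forall x, I x -> {for x, continuous g}) /\
  forall c : chart R M (dim M), atlas c ->
    smooth_on (I `&` g @^-1` chart_dom c) (c \o g).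

Lemma smooth_param_sub X M (I J : set X) (g : X -> M) : J `<=` I ->
  smooth_param I g -> smooth_param J g.
Proof.
move=> JI [g1 g2]; split=> [x /JI|c ac k]; first exact: g1.
by apply: class_C_sub (g2 c ac k) => x [/JI].
Qed.

Lemma smooth_param_local X M (I : set X) (g : X -> M) :
  (forall x, I x -> exists2 J, J x & smooth_param J g) -> smooth_param I g.
Proof.
move=> H; split=> [x /H[J Jx [+ _]]|c ac k]; first exact.
apply: class_C_local => x [/H[J Jx [_ Jg]] cx].
by exists (J `&` g @^-1` chart_dom c) => //; exact: Jg.
Qed.

Lemma smooth_param_ext X M (I : set X) (f g : X -> M) : open I ->
  (forall x, I x -> f x = g x) -> smooth_param I f -> smooth_param I g.
Proof.
move=> oI fg [f1 f2].
have g1 x : I x -> {for x, continuous g}.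
  move=> Ix; rewrite /prop_for /continuous_at -(fg _ Ix).
  apply: cvg_trans (f1 x Ix); apply: near_eq_cvg.
  by apply: filterS (open_nbhs_nbhs (conj oI Ix)) => y /fg.
split=> // c ac k.
apply: (@class_C_ext _ _ _ _ _ (c \o f)).
- by apply: open_preimage_on => //; exact: chart_dom_open.
- by move=> x [Ix _]; rewrite /= fg.
- by apply: class_C_sub (f2 c ac k) => x [Ix]; rewrite /= -fg.
Qed.

Lemma smooth_param_cst X M (I : set X) (p : M) : smooth_param I (fun=> p).
Proof.
split=> [x _|c ac k]; first exact: cst_continuous.
exact: (class_C_cst _ _ (c p)).
Qed.

Lemma smooth_param_comp X M N (I : set X) (U : set M) (g : X -> M)
    (f : M -> N) : open I -> (forall x, I x -> U (g x)) ->
  smooth_map_on U f -> smooth_param I g -> smooth_param I (f \o g).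
Proof.
move=> oI gU [f1 f2] [g1 g2].
have fg1 x : I x -> {for x, continuous (f \o g)}.
  by move=> Ix; apply: continuous_comp; [exact: g1|apply: f1; exact: gU].
split=> // d ad k; apply: class_C_local => x [Ix dx].
pose c := chart_at (g x).
have cx : chart_dom c (g x) by exact: chart_at_dom.
(* around [x], factor through the preferred chart at [g x] *)
pose J := (I `&` (f \o g) @^-1` chart_dom d) `&` (I `&` g @^-1` chart_dom c).
have oJ : open J.
  by apply: openI; apply: open_preimage_on => //; exact: chart_dom_open.
exists J => //.
apply: (@class_C_ext _ _ _ _ _ ((d \o f \o chart_inv c) \o (c \o g))) => //.
  by move=> y [_ [_ cy]] /=; rewrite chartK.
apply: (class_C_comp (U := chart_cod c `&`
  (chart_inv c @^-1` (U `&` f @^-1` chart_dom d)))) => //.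
- move=> y [[Iy dy] [_ cy]]; split; first by exists (g y).
  by rewrite /= chartK //; split=> //; exact: gU.
- by apply: class_C_sub (g2 c (chart_at_atlas _) k) => y [].
- by apply: f2 => //; exact: chart_at_atlas.
Qed.

Lemma smooth_param_chart_inv M (c : chart R M (dim M)) : atlas c ->
  smooth_param (chart_cod c) (chart_inv c).
Proof.
move=> ac; split=> [y cy|d ad]; first exact: chart_inv_cont.
exact: atlas_compat.
Qed.

Lemma smooth_param_pair X M N (I : set X) (f : X -> M) (g : X -> N) :
  open I -> smooth_param I f -> smooth_param I g ->
  smooth_param (M := prod_manifold M N) I (fun x => (f x, g x)).
Proof.
move=> oI [f1 f2] [g1 g2]; split=> [x Ix|].
  by apply: continuous_pair; [exact: f1|exact: g1].
move=> _ [c [d [ac ad ->]]] k.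
have -> : (prod_chart c d) \o (fun x => (f x, g x)) =
    (@row_mx_l R (dim M) (dim N) \o (c \o f)) +
    (@row_mx_r R (dim M) (dim N) \o (d \o g)).
  apply/funext => x /=; rewrite fctE /=.
  by rewrite /row_mx_l /row_mx_r add_row_mx addr0 add0r.
apply: (@class_C_sub _ _ _ _ ((I `&` f @^-1` chart_dom c) `&`
  (I `&` g @^-1` chart_dom d))); first by move=> x [Ix []].
have oc : open (I `&` f @^-1` chart_dom c).
  by apply: open_preimage_on => //; exact: chart_dom_open.
have od : open (I `&` g @^-1` chart_dom d).
  by apply: open_preimage_on => //; exact: chart_dom_open.
apply: class_CD; first exact: openI.
- apply: class_C_sub (@subIsetl _ _ _) _.
  apply: (class_C_lin_comp (L := @row_mx_l R _ _)) => //.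
    exact: row_mx_l_continuous.
  exact: f2.
- apply: class_C_sub (@subIsetr _ _ _) _.
  apply: (class_C_lin_comp (L := @row_mx_r R _ _)) => //.
    exact: row_mx_r_continuous.
  exact: g2.
Qed.

Lemma smooth_param_fst X M N (I : set X) (g : X -> prod_manifold M N) :
  open I -> smooth_param I g -> smooth_param I (fun x => (g x).1).
Proof.
move=> oI [g1 g2].
have cg x : I x -> {for x, continuous (fun x => (g x).1)}.
  by move=> Ix; apply: (continuous_comp (g1 x Ix)); exact: cvg_fst.
split=> // c ac k; apply: class_C_local => x [Ix cx].
pose d := chart_at (g x).2.
pose J := I `&` g @^-1` chart_dom (prod_chart c d).
have oJ : open J by apply: open_preimage_on => //; exact: chart_dom_open.
exists J; first by split=> //; split=> //=; exact: chart_at_dom.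
have H : class_C k J ((@lsubmx R 1 (dim M) (dim N)) \o (prod_chart c d \o g)).
  apply: (class_C_lin_comp (L := @lsubmx R 1 _ _)) => //.
    exact: continuous_lsubmx.
  by apply: g2; exists c, d; split=> //; exact: chart_at_atlas.
by apply: class_C_ext H => // y _ /=; rewrite row_mxKl.
Qed.

Lemma smooth_param_snd X M N (I : set X) (g : X -> prod_manifold M N) :
  open I -> smooth_param I g -> smooth_param I (fun x => (g x).2).
Proof.
move=> oI [g1 g2].
have cg x : I x -> {for x, continuous (fun x => (g x).2)}.
  by move=> Ix; apply: (continuous_comp (g1 x Ix)); exact: cvg_snd.
split=> // d ad k; apply: class_C_local => x [Ix dx].
pose c := chart_at (g x).1.
pose J := I `&` g @^-1` chart_dom (prod_chart c d).
have oJ : open J by apply: open_preimage_on => //; exact: chart_dom_open.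
exists J; first by split=> //; split=> //=; exact: chart_at_dom.
have H : class_C k J ((@rsubmx R 1 (dim M) (dim N)) \o (prod_chart c d \o g)).
  apply: (class_C_lin_comp (L := @rsubmx R 1 _ _)) => //.
    exact: continuous_rsubmx.
  by apply: g2; exists c, d; split=> //; exact: chart_at_atlas.
by apply: class_C_ext H => // y _ /=; rewrite row_mxKr.
Qed.

End smooth_param.

(** * Velocities and the chain rule *)

Section velocity.
Context {R : realType}.
Implicit Types M N : manifold R.

Local Notation velocity g t v := (@has_velocity R _ g t v).

Lemma is_derive_comp n (W : normedModType R) (g : R -> 'rV[R]_n)
    (f : 'rV[R]_n -> W) t (v : 'rV[R]_n) :
  differentiable f (g t) -> is_derive t 1 g v ->
  is_derive t 1 (f \o g) ('d f (g t) v).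
Proof.
move=> df [/derivable1_diffP dg vE].
have dfg : differentiable (f \o g) t by exact: differentiable_comp.
split; first exact/derivable1_diffP.
by rewrite deriveE // diff_comp //= -vE deriveE.
Qed.

Lemma velocity_unique M (g : R -> M) t (v w : 'rV[R]_(dim M)) :
  velocity g t v -> velocity g t w -> v = w.
Proof. by move=> [_ [_ <-]] [_ [_ <-]]. Qed.

Lemma velocity_near M (f g : R -> M) t (v : 'rV[R]_(dim M)) :
  (\forall s \near t, f s = g s) -> velocity f t v -> velocity g t v.
Proof.
move=> fg [cf df]; have fgt : f t = g t := nbhs_singleton fg.
split.
  rewrite /prop_for /continuous_at -fgt.
  by apply: cvg_trans cf; apply: near_eq_cvg; apply: filterS fg.
rewrite -fgt; apply: near_eq_is_derive df.
by apply: filterS fg => s /= ->.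
Qed.

Lemma velocity_eq M (f g : R -> M) t (v : 'rV[R]_(dim M)) :
  f =1 g -> velocity f t v -> velocity g t v.
Proof.
move=> fg; apply: velocity_near.
exact: (@filterE _ (nbhs t) (nbhs_filter t) _ fg).
Qed.

Lemma velocity_cst M (p : M) t : velocity (fun=> p) t (0 : 'rV[R]_(dim M)).
Proof.
split; first exact: cst_continuous.
exact: (is_derive_cst (chart_at p p)).
Qed.

Lemma smooth_velocity M (I : set R) (g : R -> M) t : open I ->
  smooth_curve_on I g -> I t -> exists v : 'rV[R]_(dim M), velocity g t v.
Proof.
move=> oI [g1 g2] It.
have [/(_ t) H _] := g2 _ (chart_at_atlas (g t)) 1%N.
exists ('D_1 (chart_at (g t) \o g) t); split; first exact: g1.
apply/derivableP/derivable1_diffP/H; split => //; exact: chart_at_dom.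
Qed.

Lemma velocity_pair M N (f : R -> M) (g : R -> N) t (v : 'rV[R]_(dim M))
    (w : 'rV[R]_(dim N)) : velocity f t v -> velocity g t w ->
  @has_velocity R (prod_manifold M N) (fun s => (f s, g s)) t (row_mx v w).
Proof.
move=> [cf df] [cg dg]; split; first exact: continuous_pair.
have -> : chart_at (m := prod_manifold M N) (f t, g t) \o (fun s => (f s, g s)) =
    (@row_mx_l R (dim M) (dim N) \o (chart_at (f t) \o f)) +
    (@row_mx_r R (dim M) (dim N) \o (chart_at (g t) \o g)).
  apply/funext => x /=; rewrite fctE /=.
  by rewrite /row_mx_l /row_mx_r add_row_mx addr0 add0r.
have -> : row_mx v w =
    @row_mx_l R (dim M) (dim N) v + @row_mx_r R (dim M) (dim N) w.
  by rewrite /row_mx_l /row_mx_r add_row_mx addr0 add0r.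
have cl := @row_mx_l_continuous R (dim M) (dim N).
have cr := @row_mx_r_continuous R (dim M) (dim N).
apply: is_deriveD.
- rewrite -[X in is_derive _ _ _ X](congr1 (fun h => h v)
    (diff_lin (chart_at (f t) (f t)) cl)).
  by apply: is_derive_comp df; exact: linear_differentiable.
- rewrite -[X in is_derive _ _ _ X](congr1 (fun h => h w)
    (diff_lin (chart_at (g t) (g t)) cr)).
  by apply: is_derive_comp dg; exact: linear_differentiable.
Qed.

Lemma velocity_reflect M (g : R -> M) a t (v : 'rV[R]_(dim M)) :
  velocity g (a - t) v -> velocity (fun s => g (a - s)) t (- v).
Proof.
have dr : is_derive (t : R) 1 (fun s : R => a - s) (-1).
  by apply: is_derive_eq; rewrite sub0r.
have /derivable1_diffP ddr : derivable (fun s : R => a - s) t 1 by case: dr.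
move=> [cg [/derivable1_diffP dg vE]]; split.
  apply: (@continuous_comp _ _ _ (fun s => a - s) g) => //.
  exact: differentiable_continuous.
have dd : differentiable ((chart_at (g (a - t)) \o g) \o (fun s => a - s)) t.
  exact: differentiable_comp.
split; first exact/derivable1_diffP.
have <- : 'D_1 ((chart_at (g (a - t)) \o g) \o (fun s => a - s)) t = - v.
  rewrite deriveE // diff_comp //= -(deriveE _ ddr).
  by case: dr => _ ->; rewrite linearN /= -deriveE // vE.
by [].
Qed.

(** Two-sided derivatives are determined by the values of the curve after [t]:
    this is how velocities at the break points of a path are reached from the
    smooth arc that follows. *)
Lemma velocity_right M (f g : R -> M) t e (v w : 'rV[R]_(dim M)) : t < e ->
  (forall s, t <= s <= e -> f s = g s) ->
  velocity f t v -> velocity g t w -> v = w.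
Proof.
move=> te fg [_ [fd fv]] [_ [gd gw]].
have fgt : f t = g t by apply: fg; rewrite lexx ltW.
rewrite -fv -gw /derive.
have fr := cvg_at_rightE _ _ fd; have gr := cvg_at_rightE _ _ gd.
rewrite /derive /= fr gr.
have E : \forall h \near 0^'+, f (h *: 1 + t) = g (h *: 1 + t).
  near=> h; apply: fg; rewrite [_%:A]mulr1 lerDr -lerBrDr.
  apply/andP; split; near: h; first exact: nbhs_right_ge.
  by apply: nbhs_right_le; rewrite subr_gt0.
congr (lim _); rewrite eqEsubset; split; apply: near_eq_cvg;
  by apply: filterS E => h /= ->; rewrite fgt.
Unshelve. all: by end_near. Qed.

(** Smoothness of [f] near [p], read in the chart that represents the tangent
    space at [p]; nothing is asked of [f] away from [p]. *)
Definition smooth_near M N (f : M -> N) (p : M) := exists J,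
  [/\ open J, J (chart_at p p) & smooth_param J (f \o chart_inv (chart_at p))].

Lemma velocity_comp M N (f : M -> N) (g : R -> M) t (v : 'rV[R]_(dim M)) :
  smooth_near f (g t) -> velocity g t v ->
  velocity (f \o g) t (dmap f (g t) v).
Proof.
move=> [J [oJ Jt [f1 f2]]] [cg dg].
set c := chart_at (g t) in oJ Jt f1 f2 dg *.
have cgt : chart_dom c (g t) by exact: chart_at_dom.
have near_dom : \forall s \near t, chart_dom c (g s).
  by apply: cg; apply: open_nbhs_nbhs; split=> //; exact: chart_dom_open.
have E : \forall s \near t, ((f \o chart_inv c) \o (c \o g)) s = (f \o g) s.
  by apply: filterS near_dom => s cs /=; rewrite chartK.
have C : {for t, continuous (c \o g)}.
  by apply: continuous_comp => //; exact: chart_fun_cont.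
have CF : {for t, continuous ((f \o chart_inv c) \o (c \o g))}.
  by apply: continuous_comp => //; exact: f1.
split.
  rewrite /prop_for /continuous_at -(nbhs_singleton E).
  by apply: cvg_trans CF; apply: near_eq_cvg; apply: filterS E.
have D : differentiable (chart_at (f (g t)) \o f \o chart_inv c) (c (g t)).
  have [H _] := f2 _ (chart_at_atlas (f (g t))) 1%N.
  by apply: H; split=> //=; rewrite chartK //; exact: chart_at_dom.
have := is_derive_comp (g := c \o g) D dg.
apply: near_eq_is_derive.
by apply: filterS near_dom => s cs /=; rewrite chartK.
Qed.

Lemma smooth_near_map M N (U : set M) (f : M -> N) p : open U -> U p ->
  smooth_map_on U f -> smooth_near f p.
Proof.
move=> oU Up sf; have ac := chart_at_atlas p.
have sc := smooth_param_chart_inv ac; have [cc _] := sc.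
have oJ : open (chart_cod (chart_at p) `&` chart_inv (chart_at p) @^-1` U).
  by apply: open_preimage_on => //; exact: chart_cod_open.
exists (chart_cod (chart_at p) `&` chart_inv (chart_at p) @^-1` U).
have dp := chart_at_dom p.
split=> //; first by split; [exists p|rewrite /= chartK].
apply: (smooth_param_comp (U := U)) => //; first by move=> x [].
by apply: smooth_param_sub sc => x [].
Qed.

Lemma velocity_map M N (f : M -> N) (g : R -> M) t (v : 'rV[R]_(dim M)) :
  smooth_map f -> velocity g t v -> velocity (f \o g) t (dmap f (g t) v).
Proof. by move=> sf; apply: velocity_comp; exact: smooth_near_map openT _ sf. Qed.

Lemma smooth_near_pairl M N (Q : manifold R) (F : M -> N -> Q) p q :
  smooth_map (M := prod_manifold M N) (fun z => F z.1 z.2) ->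
  smooth_near (F ^~ q) p.
Proof.
move=> sF; exists (chart_cod (chart_at p)); split.
- exact: chart_cod_open.
- by exists p => //; exact: chart_at_dom.
have oc : open (chart_cod (chart_at p)) by exact: chart_cod_open.
apply: (@smooth_param_comp _ _ (prod_manifold M N) Q _ setT
   (fun x => (chart_inv (chart_at p) x, q)) (fun z => F z.1 z.2)) => //.
apply: smooth_param_pair => //; last exact: smooth_param_cst.
by apply: smooth_param_chart_inv; exact: chart_at_atlas.
Qed.

Lemma smooth_near_pairr M N (Q : manifold R) (F : M -> N -> Q) p q :
  smooth_map (M := prod_manifold M N) (fun z => F z.1 z.2) ->
  smooth_near (F p) q.
Proof.
move=> sF; exists (chart_cod (chart_at q)); split.
- exact: chart_cod_open.
- by exists q => //; exact: chart_at_dom.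
have oc : open (chart_cod (chart_at q)) by exact: chart_cod_open.
apply: (@smooth_param_comp _ _ (prod_manifold M N) Q _ setT
   (fun x => (p, chart_inv (chart_at q) x)) (fun z => F z.1 z.2)) => //.
apply: smooth_param_pair => //; first exact: smooth_param_cst.
by apply: smooth_param_chart_inv; exact: chart_at_atlas.
Qed.

(** Leibniz rule. The differential of [F] at a pair is linear, and its values on
    [(v, 0)] and [(0, w)] are identified with the partial differentials by
    computing the velocities of [F (f s) (g t)] and [F (f t) (g s)] in two
    ways. *)
Lemma velocity_map2 M N (Q : manifold R) (F : M -> N -> Q) (f : R -> M)
    (g : R -> N) t (v : 'rV[R]_(dim M)) (w : 'rV[R]_(dim N)) :
  smooth_map (M := prod_manifold M N) (fun z => F z.1 z.2) ->
  velocity f t v -> velocity g t w ->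
  velocity (fun s => F (f s) (g s)) t
    ((dmap (F ^~ (g t)) (f t) v : 'rV[R]_(dim Q)) + dmap (F (f t)) (g t) w).
Proof.
move=> sF vf vg.
have V0 u1 u2 a b : velocity a t u1 -> velocity b t u2 -> a t = f t -> b t = g t ->
    velocity (fun s => F (a s) (b s)) t
      (dmap (M := prod_manifold M N) (fun z => F z.1 z.2) (f t, g t)
         (row_mx u1 u2)).
  move=> va vb <- <-.
  exact: (velocity_map (M := prod_manifold M N) sF (velocity_pair va vb)).
have E1 := V0 _ _ _ _ vf (velocity_cst (g t) t) erefl erefl.
have E2 := V0 _ _ _ _ (velocity_cst (f t) t) vg erefl erefl.
have F1 := velocity_comp (smooth_near_pairl (f t) (g t) sF) vf.
have F2 := velocity_comp (smooth_near_pairr (f t) (g t) sF) vg.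
rewrite (velocity_unique F1 E1) (velocity_unique F2 E2).
have := V0 _ _ _ _ vf vg erefl erefl.
rewrite /dmap -linearD /=.
by rewrite add_row_mx addr0 add0r.
Qed.

End velocity.

(** * One-forms along smooth curves *)

Section forms.
Context {R : realType}.
Implicit Types M N : manifold R.

Local Notation velocity g t v := (@has_velocity R _ g t v).

(** Near [t], the velocity of [g] at [s] is the image, under a change of charts,
    of the derivative of the coordinates of [g] in the fixed chart at [g t]. So
    the value of [w] is a combination of the smooth coefficients of [w] in that
    chart, with the coordinates of the derivative as factors: it depends
    continuously on [s]. *)
Lemma form_along_curve M (W : normedModType R) (w : one_form M W)
    (I : set R) (g : R -> M) t : smooth_form w -> open I ->
  smooth_curve_on I g -> I t ->
  exists2 Phi : R -> W, {for t, continuous Phi} &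
    \forall s \near t, forall v : 'rV[R]_(dim M),
      velocity g s v -> w (g s) v = Phi s.
Proof.
move=> [lw sw] oI [g1 g2] It.
pose c := chart_at (g t); have ac : atlas c by exact: chart_at_atlas.
pose J := I `&` g @^-1` chart_dom c.
have oJ : open J by apply: open_preimage_on => //; exact: chart_dom_open.
have Jt : J t by split=> //; exact: chart_at_dom.
have [dg cdg] := g2 c ac 1%N.
pose u s := 'd (c \o g) s (1 : R).
pose wc j (x : 'rV[R]_(dim M)) := let p := chart_inv c x in
  w p ('d (chart_at p \o chart_inv c) x (delta_mx 0 j)).
pose Phi s := \sum_j (u s 0 j) *: wc j (c (g s)).
have CPhi : class_C 0 J Phi.
  apply: class_C_sum => // j; apply: class_C_scale => //.
    apply: (class_C_lin_comp (L := row_entry j)) => //.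
      exact: coord_continuous.
    exact: cdg.
  apply: (@class_C_comp _ _ W 0 _ J (chart_cod c) (c \o g) (wc j)) => //.
  - by move=> s [_ cs]; exists (g s).
  - exact: (g2 c ac 0%N).
  - exact: (sw c (delta_mx 0 j) ac 0%N).
exists Phi; first exact: CPhi.
apply: filterS (open_nbhs_nbhs (conj oJ Jt)) => s [Is cs] v [_ dv].
have D : is_derive s 1 (c \o g) (u s).
  have ds := dg s (conj Is cs).
  by split; [exact/derivable1_diffP|rewrite deriveE].
have dc : differentiable (chart_at (g s) \o chart_inv c) ((c \o g) s).
  have [H _] := atlas_compat ac (chart_at_atlas (g s)) 1%N.
  apply: H; split; first by exists (g s).
  by rewrite /= chartK //; exact: chart_at_dom.
have E : \forall r \near s,
    ((chart_at (g s) \o chart_inv c) \o (c \o g)) r = (chart_at (g s) \o g) r.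
  apply: filterS (open_nbhs_nbhs (conj oJ (conj Is cs))) => r [_ cr] /=.
  by rewrite chartK.
have [_ vE] := near_eq_is_derive E (is_derive_comp dc D).
have -> : v = 'd (chart_at (g s) \o chart_inv c) (c (g s)) (u s).
  by case: dv => _ <-.
pose L : {linear 'rV[R]_(dim M) -> W} :=
  HB.pack (w (g s) : 'rV[R]_(dim M) -> W)
    (GRing.isLinear.Build _ _ _ _ _ (lw (g s))).
have wcE j : wc j (c (g s)) =
    L ('d (chart_at (g s) \o chart_inv c) (c (g s)) (delta_mx 0 j)).
  by rewrite /wc /= chartK.
rewrite -[LHS]/(L _) [in LHS](row_sum_delta (u s)) !linear_sum.
by apply: eq_bigr => j _; rewrite wcE !linearZ.
Qed.

Lemma form_congr_point M (W : normedModType R) (w : one_form M W) (p q : M)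
    (v : 'rV[R]_(dim M)) : p = q -> w p v = w q v.
Proof. by move=> ->. Qed.

End forms.

(** * Principal connections along curves *)

Section connection.
Context {R : realType}.
Variables (G : lie_group R) (M : manifold R) (P : principal_bundle G M).
Variable theta : one_form P (lie_algebra G).
Hypothesis ctheta : principal_connection theta.

Local Notation velocity g t v := (@has_velocity R _ g t v).

Lemma lie_mulK (g h : G) : lie_mul g (lie_mul (lie_inv g) h) = h.
Proof. by rewrite lie_mulA lie_mulrV lie_mul1. Qed.

Lemma lie_mulVK (g h : G) : lie_mul (lie_inv g) (lie_mul g h) = h.
Proof. by rewrite lie_mulA lie_mulV lie_mul1. Qed.

Lemma lie_invK (g : G) : lie_inv (lie_inv g) = g.
Proof. by rewrite -[LHS]lie_mulr1 -(lie_mulV g) lie_mulVK. Qed.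

Lemma pb_actK (u : P) (g : G) : pb_act (pb_act u g) (lie_inv g) = u.
Proof. by rewrite -pb_actM lie_mulrV pb_act1. Qed.

Lemma pb_act_smoothr (g : G) : forall u, smooth_near ((@pb_act _ _ _ P)^~ g) u.
Proof. by move=> u; apply: (smooth_near_pairl u g); exact: pb_act_smooth. Qed.

(** For [u = a k(t)] one has [a k(s) = u (k(t)^-1 k(s))], which reduces the
    claim to the defining property of a connection on fundamental vector fields, the
    curve [k(t)^-1 k(s)] passing through the unit at [s = t]. *)
Lemma connection_orbit (a : P) (k : R -> G) t (w : 'rV[R]_(dim G)) :
  velocity k t w ->
  theta (dmap (pb_act a) (k t) w) = maurer_cartan G (k t) w.
Proof.
move=> vk; have [_ _ fund] := ctheta.
pose b s := lie_mul (lie_inv (k t)) (k s).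
have b1 : b t = lie_one G by rewrite /b lie_mulV.
have vb : velocity b t (dmap (lie_mul (lie_inv (k t))) (k t) w).
  apply: velocity_comp vk; apply: smooth_near_pairr; exact: lie_mul_smooth.
pose u := pb_act a (k t).
have sn x y : smooth_near (pb_act (p := P) x) y.
  by apply: (smooth_near_pairr x y); exact: pb_act_smooth.
have V1 := velocity_comp (sn u _) vb.
have V2 := velocity_comp (sn a _) vk.
have E s : (pb_act u \o b) s = (pb_act a \o k) s.
  by rewrite /= /u /b -pb_actM lie_mulK.
have EV := velocity_unique V2 (velocity_eq E V1).
rewrite -[LHS]/(@theta (pb_act a (k t)) (dmap (pb_act a) (k t) w : 'rV[R]_(dim P))).
rewrite EV.
have F g (Y : 'rV[R]_(dim G)) : g = lie_one G ->
    theta (dmap (pb_act u) g Y) = Y by move=> ->; exact: fund.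
apply: etrans (F _ _ b1).
by apply: form_congr_point; rewrite /b lie_mulV pb_act1.
Qed.

(** The gauge formula. The Leibniz rule splits the velocity in two parts: on
    the first one equivariance of the connection gives the term in [Ad], and
    the second one is tangent to an orbit. *)
Lemma connection_leibniz (a : R -> P) (k : R -> G) t (v : 'rV[R]_(dim P))
    (w : 'rV[R]_(dim G)) : velocity a t v -> velocity k t w ->
  exists2 z : 'rV[R]_(dim P), velocity (fun s => pb_act (a s) (k s)) t z &
    theta (z : tangent (pb_act (a t) (k t))) =
      lie_Ad (lie_inv (k t)) (theta (v : tangent (a t))) +
      maurer_cartan G (k t) w.
Proof.
move=> va vk; have [[lth _] adj _] := ctheta.
exists ((dmap ((@pb_act _ _ _ P) ^~ (k t)) (a t) v : 'rV[R]_(dim P)) +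
        dmap (pb_act (a t)) (k t) w).
  apply: (velocity_map2 (F := @pb_act _ _ _ P)) => //; exact: pb_act_smooth.
rewrite -(connection_orbit (a t) vk) -(adj (k t) (a t) v).
have := lth (pb_act (a t) (k t)) 1 (dmap ((@pb_act _ _ _ P) ^~ (k t)) (a t) v)
  (dmap (pb_act (a t)) (k t) w).
by rewrite !scale1r.
Qed.

Lemma lie_Ad0 (g : G) : lie_Ad g (0 : lie_algebra G) = 0.
Proof. by rewrite /lie_Ad /dmap linear0. Qed.

Lemma connection0 (u : P) : theta (0 : tangent u) = 0.
Proof.
have [[lth _] _ _] := ctheta.
by have := lth u (-1) 0 0; rewrite scaler0 addr0 scaleN1r addNr.
Qed.

Lemma connectionN (u : P) (v : 'rV[R]_(dim P)) :
  theta ((- v) : tangent u) = - theta (v : tangent u).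
Proof.
have [[lth _] _ _] := ctheta.
by have := lth u (-1) v 0; rewrite connection0 !addr0 !scaleN1r.
Qed.

(** Injectivity of [Ad], on the values of [theta]: acting by [g] and then by its
    inverse gives back the vector [v]. *)
Lemma connection_Ad_eq0 (a : R -> P) t (v : 'rV[R]_(dim P)) (g : G) :
  velocity a t v -> lie_Ad (lie_inv g) (theta (v : tangent (a t))) = 0 ->
  theta (v : tangent (a t)) = 0.
Proof.
move=> va; have [_ adj _] := ctheta; rewrite -(adj g (a t) v) => H.
have V1 := velocity_comp (pb_act_smoothr g (a t)) va.
have V2 := velocity_comp (pb_act_smoothr (lie_inv g) _) V1.
have E s : (((@pb_act _ _ _ P)^~ (lie_inv g)) \o (((@pb_act _ _ _ P)^~ g) \o a)) s
    = a s by rewrite /= pb_actK.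
rewrite (velocity_unique va (velocity_eq E V2)).
have := adj (lie_inv g) (pb_act (a t) g) (dmap ((@pb_act _ _ _ P)^~ g) (a t) v).
rewrite /pullback_form in H *; rewrite H lie_Ad0 => <-.
by apply: form_congr_point; rewrite /= pb_actK.
Qed.

End connection.

(** * Piecewise smooth curves *)

Section piecewise.
Context {R : realType}.
Implicit Types M N : manifold R.

(** The hypothesis of [piecewise_smooth_arc] without [a < b], so that it passes
    to subintervals. *)
Definition smooth_arc M (g : R -> M) (a b : R) := exists I d,
  [/\ open I, smooth_curve_on I d &
      forall t, a <= t <= b -> I t /\ g t = d t].

Lemma smooth_arc_sub M (g : R -> M) a b a' b' :
  smooth_arc g a b -> a <= a' -> b' <= b -> smooth_arc g a' b'.
Proof.
move=> [I [d [oI sd gd]]] aa bb; exists I, d; split=> // t /andP[at_ tb].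
by apply: gd; rewrite (le_trans aa) // (le_trans tb).
Qed.

Lemma piecewise_smooth_of_arc M (g : R -> M) a b :
  a < b -> smooth_arc g a b -> piecewise_smooth g a b.
Proof. by move=> ab [I [d [oI sd gd]]]; exact: piecewise_smooth_arc gd. Qed.

Lemma piecewise_smooth_lt M (g : R -> M) a b : piecewise_smooth g a b -> a < b.
Proof. by elim=> // {}a {}b c _ ab _; exact: lt_trans. Qed.

Lemma piecewise_smooth_ext M (f g : R -> M) a b :
  (forall t, a <= t <= b -> f t = g t) -> piecewise_smooth f a b ->
  piecewise_smooth g a b.
Proof.
move=> + pf; elim: pf => [{}a {}b I d ab oI sd fd fg|{}a b' c p1 IH1 p2 IH2 fg].
  apply: (piecewise_smooth_arc (I := I) (delta := d)) => // t tab.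
  by rewrite -fg //; exact: fd.
have lt1 := piecewise_smooth_lt p1; have lt2 := piecewise_smooth_lt p2.
by apply: (piecewise_smooth_cat (b := b')); [apply: IH1|apply: IH2];
  move=> t /andP[? ?]; apply: fg; lra.
Qed.

Lemma piecewise_smooth_map M N (f : M -> N) (g : R -> M) a b :
  (forall I d, open I -> smooth_curve_on I d -> smooth_curve_on I (f \o d)) ->
  piecewise_smooth g a b -> piecewise_smooth (f \o g) a b.
Proof.
move=> sf; elim=> [{}a {}b I d ab oI sd gd|{}a b' c _ p1 _ p2].
  apply: (piecewise_smooth_arc (I := I) (delta := f \o d)) => //.
    exact: sf.
  by move=> t /gd[It /= ->].
exact: piecewise_smooth_cat p1 p2.
Qed.

Lemma piecewise_smooth_reflect M (g : R -> M) a b r :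
  piecewise_smooth g a b -> piecewise_smooth (fun t => g (r - t)) (r - b) (r - a).
Proof.
elim=> [{}a {}b I d ab oI [d1 d2] gd|{}a b' c _ p1 _ p2]; last first.
  exact: piecewise_smooth_cat p2 p1.
have cr (x : R) : {for x, continuous (fun x : R => r - x)}.
  by apply: continuousB; [exact: cst_continuous|].
apply: (piecewise_smooth_arc (I := [set t | I (r - t)])
  (delta := fun t => d (r - t))).
- lra.
- by apply: (open_comp (f := fun x : R => r - x)) => // x _; exact: cr.
- split=> [t /= It|c ac k].
    by apply: (@continuous_comp _ _ _ (fun x => r - x) d) => //; exact: d1.
  apply: (@class_C_reflect _ _ _ r (I `&` d @^-1` chart_dom c) (c \o d)).
    by apply: open_preimage_on => //; exact: chart_dom_open.
  exact: d2.
- by move=> t /andP[? ?]; apply: gd; lra.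
Qed.

Lemma piecewise_smooth_right M (g : R -> M) a b t : piecewise_smooth g a b ->
  a <= t < b -> exists e, [/\ t < e, e <= b & smooth_arc g t e].
Proof.
elim=> [{}a {}b I d ab oI sd gd|{}a b' c p1_ p1 p2_ p2] /andP[at_ tb].
  exists b; split=> //; exists I, d; split=> // s /andP[? ?].
  by apply: gd; lra.
have [tb'|b't] := ltP t b'.
  have [|e [? ? ?]] := p1; first by rewrite at_.
  by exists e; split=> //; have := piecewise_smooth_lt p2_; lra.
by have [|e [? ? ?]] := p2; [rewrite b't|exists e].
Qed.

Lemma piecewise_smooth_left M (g : R -> M) a b t : piecewise_smooth g a b ->
  a < t <= b -> exists s, [/\ s < t, a <= s & smooth_arc g s t].
Proof.
elim=> [{}a {}b I d ab oI sd gd|{}a b' c p1_ p1 _ p2] /andP[at_ tb].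
  exists a; split=> //; exists I, d; split=> // s /andP[? ?].
  by apply: gd; lra.
have [tb'|b't] := leP t b'.
  by have [|e [? ? ?]] := p1; [rewrite at_|exists e].
have [|e [? ? ?]] := p2; first by rewrite b't.
by exists e; split=> //; have := piecewise_smooth_lt p1_; lra.
Qed.

(** Compactness of the segment, in the form of an induction: consider the
    supremum of the [t] with [Q a t]. It is reached by the condition on its
    left, and exceeded by the condition on its right unless it is [b]. *)
Lemma interval_chaining (Q : R -> R -> Prop) a b : a < b ->
  (forall x y z, x < y -> y < z -> Q x y -> Q y z -> Q x z) ->
  (forall t, a <= t < b -> exists2 e, t < e &
     forall e', t < e' -> e' <= e -> Q t e') ->
  (forall t, a < t <= b -> exists2 s, s < t &
     forall s', s' < t -> s <= s' -> Q s' t) ->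
  Q a b.
Proof.
move=> ab Qcat Qr Ql.
pose S := [set t | a < t <= b /\ Q a t].
have [e0 ae0 Qe0] := Qr a (introT andP (conj (lexx a) ab)).
have Sm : S (Num.min e0 b).
  split; first by rewrite lt_min ae0 ab ge_min lexx orbT.
  by apply: Qe0; rewrite ?lt_min ?ae0 ?ab // ge_min lexx.
have hS : has_sup S by split; [exists (Num.min e0 b)|exists b => t [/andP[]]].
have ubS := sup_upper_bound hS; have ac := ubS _ Sm.
have {}ac : a < sup S by apply: lt_le_trans ac; rewrite lt_min ae0.
have cb : sup S <= b by apply: ge_sup; [exists (Num.min e0 b)|move=> t [/andP[]]].
have [s sc Qs] := Ql (sup S) (introT andP (conj ac cb)).
have [r [/andP[ar rb] Qr'] sr] : exists2 r, S r & s < r.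
  have sc' : 0 < sup S - s by lra.
  by have [r Sr rs] := sup_adherent sc' hS; exists r => //; lra.
have Qc : Q a (sup S).
  have rc : r <= sup S by apply: ubS; split=> //; rewrite ar.
  move: rc; rewrite le_eqVlt => /orP[/eqP<- //|rc].
  by apply: (Qcat _ r) => //; apply: Qs => //; exact: ltW.
have [cb'|bc] := ltP (sup S) b; last by have <- : sup S = b by lra.
have [|e ce Qe] := Qr (sup S); first by rewrite cb' ltW.
have cm : sup S < Num.min e b by rewrite lt_min ce cb'.
have : S (Num.min e b).
  split; first by rewrite (lt_trans ac) //= ge_min lexx orbT.
  by apply: Qcat Qc _ => //; apply: Qe => //; rewrite ge_min lexx.
by move/ubS; rewrite leNgt cm.
Qed.

Lemma smooth_arc_pair M N (f : R -> M) (g : R -> N) a b :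
  smooth_arc f a b -> smooth_arc g a b ->
  smooth_arc (M := prod_manifold M N) (fun t => (f t, g t)) a b.
Proof.
move=> [I [d [oI sd fd]]] [J [d' [oJ sd' gd']]].
exists (I `&` J), (fun t => (d t, d' t)); split; first exact: openI.
  apply: smooth_param_pair; first exact: openI.
    by apply: smooth_param_sub sd; exact: subIsetl.
  by apply: smooth_param_sub sd'; exact: subIsetr.
by move=> t tab; have [? ->] := fd _ tab; have [? ->] := gd' _ tab.
Qed.

(** The two curves may have different break points; chaining intervals replaces
    the choice of a common subdivision. *)
Lemma piecewise_smooth_pair M N (f : R -> M) (g : R -> N) a b :
  piecewise_smooth f a b -> piecewise_smooth g a b ->
  piecewise_smooth (M := prod_manifold M N) (fun t => (f t, g t)) a b.
Proof.
move=> pf pg; apply: interval_chaining (piecewise_smooth_lt pf) _ _ _.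
- by move=> x y z _ _; exact: piecewise_smooth_cat.
- move=> t tab.
  have [e1 [te1 _ A1]] := piecewise_smooth_right pf tab.
  have [e2 [te2 _ A2]] := piecewise_smooth_right pg tab.
  exists (Num.min e1 e2); first by rewrite lt_min te1.
  move=> e te; rewrite le_min => /andP[l1 l2].
  apply: piecewise_smooth_of_arc => //.
  by apply: smooth_arc_pair;
    [exact: smooth_arc_sub A1 _ l1|exact: smooth_arc_sub A2 _ l2].
- move=> t tab.
  have [s1 [ts1 _ A1]] := piecewise_smooth_left pf tab.
  have [s2 [ts2 _ A2]] := piecewise_smooth_left pg tab.
  exists (Num.max s1 s2); first by rewrite gt_max ts1.
  move=> s st; rewrite ge_max => /andP[l1 l2].
  apply: piecewise_smooth_of_arc => //.
  by apply: smooth_arc_pair;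
    [exact: smooth_arc_sub A1 l1 _|exact: smooth_arc_sub A2 l2 _].
Qed.

Lemma piecewise_smooth_map2 M N (Q : manifold R) (F : M -> N -> Q)
    (f : R -> M) (g : R -> N) a b :
  smooth_map (M := prod_manifold M N) (fun z => F z.1 z.2) ->
  piecewise_smooth f a b -> piecewise_smooth g a b ->
  piecewise_smooth (fun t => F (f t) (g t)) a b.
Proof.
move=> sF pf pg.
apply: (piecewise_smooth_map (M := prod_manifold M N) (f := fun z => F z.1 z.2)
  _ (piecewise_smooth_pair pf pg)) => I d oI.
exact: (smooth_param_comp (M := prod_manifold M N) oI _ sF).
Qed.

Lemma piecewise_smooth_concat M (f g : R -> M) a m b : f m = g m ->
  piecewise_smooth f a m -> piecewise_smooth g m b ->
  piecewise_smooth (fun t => if t <= m then f t else g t) a b.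
Proof.
move=> fg pf pg; apply: (piecewise_smooth_cat (b := m)).
  by apply: piecewise_smooth_ext pf => t /andP[_ ->].
apply: piecewise_smooth_ext pg => t /andP[mt _].
case: ifPn => // tm; have -> : t = m by apply/eqP; rewrite eq_le tm.
by rewrite fg.
Qed.

End piecewise.

(** * Inverses in the holonomy set, and trivializations *)

Section holonomy_inverse.
Context {R : realType}.
Variables (G : lie_group R) (M : manifold R) (P : principal_bundle G M).
Variable theta : one_form P (lie_algebra G).
Hypothesis ctheta : principal_connection theta.

Lemma smooth_param_act_cst (X : normedModType R) (I : set X) (c : X -> P)
    (g : G) : open I -> smooth_param I c ->
  smooth_param I (fun x => pb_act (c x) g).
Proof.
move=> oI sc.
apply: (@smooth_param_comp _ _ (prod_manifold P G) P _ setT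
  (fun x => (c x, g)) (fun z => pb_act z.1 z.2)) => //.
  exact: pb_act_smooth.
by apply: smooth_param_pair => //; exact: smooth_param_cst.
Qed.

(** Reverse a horizontal path and translate it by the inverse of its holonomy,
    so that it starts at [u] again; horizontality is kept by both operations. *)
Lemma holonomy_inv (u : P) (g : G) :
  holonomy theta u g -> holonomy theta u (lie_inv g).
Proof.
move=> [c [pc c0 c1 hc]]; have [_ adj _] := ctheta.
pose c' s := pb_act (c (1 - s)) (lie_inv g).
exists c'; split.
- have := piecewise_smooth_reflect 1 pc; rewrite subrr subr0 => pc'.
  apply: (piecewise_smooth_map (f := (@pb_act _ _ _ P)^~ (lie_inv g)) _ pc').
  by move=> I d oI; exact: smooth_param_act_cst.
- by rewrite /c' subr0 c1 pb_actK.
- by rewrite /c' subrr c0.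
- move=> t v t01 vc'.
  have V := velocity_comp (pb_act_smoothr g (c' t)) vc'.
  set X := dmap _ _ _ in V.
  have V' : @has_velocity R P c (1 - t) (- X : 'rV[R]_(dim P)).
    have e : 1 - (1 - t) = t by lra.
    have : @has_velocity R P ((@pb_act _ _ _ P)^~ g \o c') (1 - (1 - t))
        (X : 'rV[R]_(dim P)).
      by rewrite e.
    move=> /velocity_reflect; apply: velocity_eq => s /=.
    rewrite /c' -pb_actM lie_mulV pb_act1; congr c; lra.
  have := hc (1 - t) (- X : 'rV[R]_(dim P)).
  move=> H; have {}H : theta (- X : tangent (c (1 - t))) = 0.
    apply: H => //; lra.
  move: H; rewrite (connectionN ctheta) => /eqP; rewrite oppr_eq0 => /eqP H.
  apply: (connection_Ad_eq0 ctheta (g := g) vc').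
  have := adj g (c' t) v; rewrite /pullback_form -/X => <-.
  rewrite -[RHS]H; apply: form_congr_point.
  by rewrite /c' -pb_actM lie_mulV pb_act1.
Qed.

(** By equivariance, a trivialization is recovered from the section
    [x |-> psi (x, 1)]. *)
Lemma trivialization_act U phi psi (x : M) (h : G) :
  local_trivialization (@pb_proj _ _ _ P) (@pb_act _ _ _ P) U phi psi -> U x ->
  psi (x, h) = pb_act (psi (x, lie_one G)) h.
Proof.
move=> [oU _ phiK psiK equi] Ux.
have [qx phix] := psiK (x, lie_one G) Ux.
have Uq : U (pb_proj (psi (x, lie_one G))) by rewrite qx.
have := equi _ h Uq; rewrite phix /= lie_mul1 => <-.
by have [|_ ->] := phiK (pb_act (psi (x, lie_one G)) h); rewrite ?pb_proj_act.
Qed.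

End holonomy_inverse.

(** * Factoring curves of the extended bundle *)

Section extended.
Context {R : realType}.
Variables (G : lie_group R) (H : closed_subgroup G) (M : manifold R).
Variables (P : principal_bundle H M) (E : extended_bundle P).

(** In the trivializations induced by [(phi, psi)], the inclusion of [P] is the
    map [(x, h) |-> (x, h)] from [U * H] to [U * G], since
    [psi (x, h) = psi (x, 1) h] has the same class as [(psi (x, 1), h)]. *)
Lemma ext_incl_smooth_param (X : normedModType R) (I : set X) (c : X -> P) :
  open I -> smooth_param I c -> smooth_param I (ext_incl E \o c).
Proof.
move=> oI sc; apply: smooth_param_local => x Ix.
have [U [phi [psi [Ux triv]]]] := pb_trivial P (pb_proj (c x)).
have [phi' [_ [_ sphi'] _ _ _]] := ext_trivial E triv.
have [oU [sphi _] phiK _ _] := triv.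
have sq : smooth_param I (@pb_proj _ _ _ P \o c).
  by apply: (smooth_param_comp (U := setT)) sc => //; exact: pb_proj_smooth.
pose J := I `&` (@pb_proj _ _ _ P \o c) @^-1` U.
have oJ : open J by apply: open_preimage_on => //; case: sq.
exists J => //.
have sc' : smooth_param J c by apply: smooth_param_sub sc => ? [].
have sphic : smooth_param (M := prod_manifold M H) J (phi \o c).
  by apply: (smooth_param_comp _ _ sphi) => // y [].
have s1 : smooth_param J (fun y => (phi (c y)).1).
  exact: (smooth_param_fst oJ sphic).
have s2 : smooth_param J (@sub_incl _ _ H \o (fun y => (phi (c y)).2)).
  apply: (smooth_param_comp (U := setT)) (smooth_param_snd oJ sphic) => //.
  exact: sub_incl_smooth.
have s3 := smooth_param_pair oJ s1 s2.
have s4 := smooth_param_comp oJ _ sphi' s3.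
apply: smooth_param_ext oJ _ (s4 _) => y [Iy Uy]; last first.
  by split=> //=; have [-> _] := phiK _ Uy.
have [e1 e2] := phiK _ Uy; rewrite /= /ext_incl.
apply/ext_class_eq; exists (phi (c y)).2; split; last by rewrite lie_mulr1.
rewrite -(trivialization_act _ triv); last by rewrite e1.
by rewrite -surjective_pairing.
Qed.

Lemma ext_incl_smooth_near (u : P) : smooth_near (ext_incl E) u.
Proof.
have oc : open (chart_cod (chart_at u)) by exact: chart_cod_open.
exists (chart_cod (chart_at u)); split=> //.
  by exists u => //; exact: chart_at_dom.
apply: ext_incl_smooth_param => //.
by apply: smooth_param_chart_inv; exact: chart_at_atlas.
Qed.

(** The initial values [u0] and [g0] are universally quantified so that
    factorizations on adjacent intervals fit together. *)
Definition factorizable (c : R -> E) (a b : R) := forall u0 g0,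
  ext_incl E u0 = pb_act (c a) g0 -> exists (d : R -> P) (g : R -> G),
  [/\ piecewise_smooth d a b, piecewise_smooth g a b, d a = u0, g a = g0 &
      forall t, a <= t <= b -> ext_incl E (d t) = pb_act (c t) (g t)].

Lemma factorizable_cat c x y z : x < y -> y < z ->
  factorizable c x y -> factorizable c y z -> factorizable c x z.
Proof.
move=> xy yz L1 L2 u0 g0 /L1[d1 [g1 [pd1 pg1 d10 g10 E1]]].
have [|d2 [g2 [pd2 pg2 d20 g20 E2]]] := L2 (d1 y) (g1 y).
  by apply: E1; rewrite lexx ltW.
exists (fun t => if t <= y then d1 t else d2 t).
exists (fun t => if t <= y then g1 t else g2 t); split.
- exact: piecewise_smooth_concat.
- exact: piecewise_smooth_concat.
- by rewrite ltW.
- by rewrite ltW.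
- move=> t /andP[xt tz]; case: ifPn => ty; first by apply: E1; rewrite xt.
  by apply: E2; rewrite tz ltW // ltNge.
Qed.

(** Over a trivializing open set, write [c(t) = (psi (x(t), 1), k(t))] and take
    [d(t) = psi (x(t), h)] and [g(t) = k(t)^-1 h]; the constant [h] in [H]
    is the freedom that is needed to match the initial values. *)
Lemma factorizable_local (c : R -> E) a b U phi psi : a < b ->
  local_trivialization (@pb_proj _ _ _ P) (@pb_act _ _ _ P) U phi psi ->
  smooth_arc c a b -> (forall t, a <= t <= b -> U (pb_proj (c t))) ->
  factorizable c a b.
Proof.
move=> ab triv [I [d [oI sd cd]]] cU u0 g0 init.
have [phi' [_ [sphi' _] phi'K _ _]] := ext_trivial E triv.
have [oU [_ spsi] _ psiK _] := triv.
have sq : smooth_param I (@pb_proj _ _ _ E \o d).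
  by apply: (smooth_param_comp (U := setT)) sd => //; exact: pb_proj_smooth.
pose J := I `&` (@pb_proj _ _ _ E \o d) @^-1` U.
have oJ : open J by apply: open_preimage_on => //; case: sq.
have sd' : smooth_param J d by apply: smooth_param_sub sd => ? [].
have sphid : smooth_param (M := prod_manifold M G) J (phi' \o d).
  by apply: (smooth_param_comp _ _ sphi') => // y [].
have s1 := smooth_param_fst oJ sphid; have s2 := smooth_param_snd oJ sphid.
pose x t := (phi' (d t)).1; pose k t := (phi' (d t)).2.
have Ux t : J t -> U (x t) by move=> [_ Ut]; rewrite /x; have [-> _] := phi'K _ Ut.
have dE t : J t -> d t = pb_act (ext_incl E (psi (x t, lie_one H))) (k t).
  by move=> [_ Ut]; have [_ {1}<-] := phi'K _ Ut; rewrite /ext_incl ext_act lie_mul1.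
have cJ t : a <= t <= b -> J t /\ c t = d t.
  by move=> tab; have [It <-] := cd _ tab; split=> //; split=> //=;
    have [_ <-] := cd _ tab; exact: cU.
have aab : a <= a <= b by rewrite lexx ltW.
have [Ja ca] := cJ _ aab.
have := init; rewrite ca dE // -pb_actM /ext_incl ext_act lie_mul1.
move=> /esym /ext_class_eq[h [u0E kE]]; rewrite lie_mulr1 in kE.
pose d1 t := psi (x t, h); pose g1 t := lie_mul (lie_inv (k t)) (sub_incl h).
have J1 : smooth_curve_on J d1.
  apply: (@smooth_param_comp _ _ (prod_manifold M H) P _ (U `*` setT)
    (fun t => (x t, h)) psi) => //.
    by move=> t /Ux.
  by apply: smooth_param_pair => //; exact: smooth_param_cst.
have J2 : smooth_curve_on J g1.
  apply: (@smooth_param_comp _ _ (prod_manifold G G) G _ setT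
    (fun t => (lie_inv (k t), sub_incl h)) (fun z => lie_mul z.1 z.2)) => //.
    exact: lie_mul_smooth.
  apply: smooth_param_pair => //; last exact: smooth_param_cst.
  apply: (smooth_param_comp (U := setT)) s2 => //; exact: lie_inv_smooth.
exists d1, g1; split.
- by apply: (piecewise_smooth_arc (I := J) (delta := d1)) => // t /cJ[].
- by apply: (piecewise_smooth_arc (I := J) (delta := g1)) => // t /cJ[].
- by rewrite /d1 (trivialization_act _ triv) //; exact: Ux.
- by rewrite /g1 -kE lie_mulVK.
- move=> t /cJ[Jt ->]; rewrite dE // -pb_actM /g1 lie_mulK /ext_incl ext_act.
  apply/esym/ext_class_eq; exists h; split; last by rewrite lie_mul1 lie_mulr1.
  by rewrite /d1 (trivialization_act _ triv) //; exact: Ux.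
Qed.

Lemma factorizable_piecewise_smooth (c : R -> E) a b :
  piecewise_smooth c a b -> factorizable c a b.
Proof.
have arc_near I (d : R -> E) U t : open I -> smooth_curve_on I d -> I t ->
    open U -> U (pb_proj (d t)) ->
    exists2 e, 0 < e & forall s, `|t - s| < e -> U (pb_proj (d s)).
  move=> oI [cd _] It oU Ut.
  have cq : {for t, continuous (@pb_proj _ _ _ E \o d)}.
    apply: continuous_comp; first exact: cd.
    by have [H' _] := pb_proj_smooth E; exact: H'.
  have := cq _ (open_nbhs_nbhs (conj oU Ut)).
  by move=> /nbhs_ballP[e /= e0 He]; exists e => // s; apply: He.
move=> pc; apply: interval_chaining (piecewise_smooth_lt pc) _ _ _.
- exact: factorizable_cat.
- move=> t tab; have [e [te _ A]] := piecewise_smooth_right pc tab.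
  have [U [phi [psi [Ux triv]]]] := pb_trivial P (pb_proj (c t)).
  have [I [d [oI sd cd]]] := A; have [oU _ _ _ _] := triv.
  have [It ct] : I t /\ c t = d t by apply: cd; rewrite lexx ltW.
  rewrite ct in Ux.
  have [r r0 Hr] := arc_near I d U t oI sd It oU Ux.
  (* half of the radius, as the conclusion is about closed intervals *)
  exists (Num.min e (t + r / 2)); first by rewrite lt_min te; lra.
  move=> e' te'; rewrite le_min => /andP[e'e e'r].
  apply: factorizable_local triv _ _ => //; first exact: smooth_arc_sub A _ e'e.
  move=> s /andP[ts se]; have [|_ ->] := cd s; first by rewrite ts (le_trans se).
  apply: Hr; rewrite distrC ger0_norm; lra.
- move=> t tab; have [e [te _ A]] := piecewise_smooth_left pc tab.
  have [U [phi [psi [Ux triv]]]] := pb_trivial P (pb_proj (c t)).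
  have [I [d [oI sd cd]]] := A; have [oU _ _ _ _] := triv.
  have [It ct] : I t /\ c t = d t by apply: cd; rewrite lexx ltW.
  rewrite ct in Ux.
  have [r r0 Hr] := arc_near I d U t oI sd It oU Ux.
  exists (Num.max e (t - r / 2)); first by rewrite gt_max te; lra.
  move=> e' te'; rewrite ge_max => /andP[e'e e'r].
  apply: factorizable_local triv _ _ => //; first exact: smooth_arc_sub A e'e _.
  move=> s /andP[ts se]; have [|_ ->] := cd s; first by rewrite se (le_trans e'e).
  apply: Hr; rewrite ger0_norm; lra.
Qed.

End extended.

(** * Intrinsic and extrinsic holonomy *)

Section lie_group_inverse.
Context {R : realType}.
Variable G : lie_group R.

Lemma lie_inv1 : lie_inv (lie_one G) = lie_one G.
Proof. by rewrite -[LHS]lie_mul1 lie_mulrV. Qed.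

Lemma lie_invM (g h : G) :
  lie_inv (lie_mul g h) = lie_mul (lie_inv h) (lie_inv g).
Proof.
rewrite -[RHS]lie_mulr1 -(lie_mulrV (lie_mul g h)) -!lie_mulA.
by rewrite lie_mulVK lie_mulVK.
Qed.

End lie_group_inverse.

Section cartan.
Context {R : realType}.
Variables (K : model_geometry R) (M : manifold R) (C : cartan_geometry K M).
Variables (E : extended_bundle C).
Variable theta : one_form E (lie_algebra (model_group K)).
Hypothesis ctheta : principal_connection theta.
Hypothesis theta_extends : forall (u : C) (v : tangent u),
  pullback_form (ext_incl E) theta u v = cartan_form C u v.

Local Notation G := (model_group K).
Local Notation velocity g t v := (@has_velocity R _ g t v).

(** Both sides are the value of [theta] on the velocity of
    [s |-> ext_incl (d s)], computed from [theta_extends] and from the gauge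
    formula. Hence [c] is horizontal exactly where [d] and [g] have the same
    form. *)
Lemma cartan_form_factor (d : R -> C) (c : R -> E) (g : R -> G) t
    (v : 'rV[R]_(dim C)) (z : 'rV[R]_(dim E)) (w : 'rV[R]_(dim G)) :
  (\forall s \near t, ext_incl E (d s) = pb_act (c s) (g s)) ->
  velocity d t v -> velocity c t z -> velocity g t w ->
  cartan_form C (d t) v =
    lie_Ad (lie_inv (g t)) (theta (z : tangent (c t))) + maurer_cartan G (g t) w.
Proof.
move=> dcg vd vc vg.
have V1 := velocity_comp (ext_incl_smooth_near E (d t)) vd.
have [y vy <-] := connection_leibniz ctheta vc vg.
have Ey := velocity_unique vy (velocity_near dcg V1).
rewrite -theta_extends /pullback_form Ey.
by apply: form_congr_point; exact: (nbhs_singleton dcg).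
Qed.

(** If [g] is the development of [d], then [ext_incl (d s) * g(s)^-1] is
    horizontal with holonomy the inverse of [a]. At a break point [t] of [d] or
    [g] this curve may still have a velocity; horizontality there follows from
    the times just after [t], by continuity of the connection along the smooth
    arc that starts at [t]. *)
Lemma intrinsic_sub_holonomy (u : C) (a : G) :
  intrinsic_holonomy u a -> holonomy theta (ext_incl E u) a.
Proof.
move=> [d [g [h [pd d0 d1 [pg g0 dg] ->]]]].
rewrite -[X in holonomy _ _ X]lie_invK; apply: holonomy_inv => //.
pose hat (d : R -> C) (g : R -> G) s : E :=
  pb_act (ext_incl E (d s)) (lie_inv (g s)).
have hatE d' g' s : ext_incl E (d' s) = pb_act (hat d' g' s) (g' s).
  by rewrite /hat -pb_actM lie_mulV pb_act1.
exists (hat d g); split.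
- apply: piecewise_smooth_map2.
  + exact: pb_act_smooth.
  + apply: (piecewise_smooth_map (f := ext_incl E)) pd => I c oI.
    exact: ext_incl_smooth_param.
  + apply: (piecewise_smooth_map (f := @lie_inv _ G)) pg => I c oI.
    by apply: (smooth_param_comp (U := setT)) => //; exact: lie_inv_smooth.
- by rewrite /hat d0 g0 lie_inv1 pb_act1.
- rewrite /hat /ext_incl !ext_act !lie_mul1; apply/ext_class_eq; exists h.
  by split=> //; rewrite lie_invM lie_mulA lie_mulrV lie_mul1.
move=> t v t01 vt; have /andP[t0 t1] := t01.
have [e1 [te1 e11 [I [d' [oI sd' dd']]]]] :
    exists e, [/\ t < e, e <= 1 & smooth_arc d t e].
  by apply: piecewise_smooth_right pd _; rewrite ltW.
have [e2 [te2 e21 [J [g' [oJ sg' gg']]]]] :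
    exists e, [/\ t < e, e <= 1 & smooth_arc g t e].
  by apply: piecewise_smooth_right pg _; rewrite ltW.
have oIJ : open (I `&` J) by exact: openI.
have [It _] : I t /\ d t = d' t by apply: dd'; rewrite lexx ltW.
have [Jt _] : J t /\ g t = g' t by apply: gg'; rewrite lexx ltW.
have shat : smooth_curve_on (I `&` J) (hat d' g').
  apply: (@smooth_param_comp _ _ (prod_manifold E G) E _ setT
    (fun s => (ext_incl E (d' s), lie_inv (g' s)))
    (fun z => pb_act z.1 z.2)) => //.
    exact: pb_act_smooth.
  apply: smooth_param_pair => //.
    apply: ext_incl_smooth_param => //.
    by apply: smooth_param_sub sd'; exact: subIsetl.
  apply: (smooth_param_comp (U := setT)) => //; first exact: lie_inv_smooth.
  by apply: smooth_param_sub sg'; exact: subIsetr.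
have [Phi cPhi PhiE] := form_along_curve (let: And3 s _ _ := ctheta in s)
  oIJ shat (conj It Jt).
have [v' vt'] := smooth_velocity oIJ shat (conj It Jt).
pose e := Num.min e1 e2.
have te : t < e by rewrite lt_min te1.
have arcE s : t <= s <= e -> [/\ I s, d s = d' s, J s & g s = g' s].
  rewrite le_min => /andP[ts /andP[s1 s2]].
  by have [|? ?] := dd' s; rewrite ?ts //; have [|? ?] := gg' s; rewrite ?ts.
(* the velocity at [t] is that of the arc which starts at [t] *)
have vv' : v = v'.
  apply: (velocity_right te _ vt vt') => s /arcE[_ ds _ gs].
  by rewrite /hat ds gs.
have hatt : hat d g t = hat d' g' t.
  by have [|_ dt _ gt] := arcE t; [rewrite lexx ltW|rewrite /hat dt gt].
have -> : theta v = Phi t.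
  rewrite vv' -(nbhs_singleton PhiE v' vt'); exact: form_congr_point.
(* [Phi] is continuous at [t] and vanishes just after [t] *)
have H1 : Phi s @[s --> t^'+] --> Phi t by exact: cvg_at_right_filter.
apply: (cvg_unique _ H1) => //.
have H2 : (fun=> 0 : lie_algebra G) s @[s --> t^'+] --> (0 : lie_algebra G).
  exact: cvg_cst.
apply: cvg_trans H2; apply: near_eq_cvg.
have PhiE' : \forall s \near t^'+, forall v : 'rV[R]_(dim E),
    velocity (hat d' g') s v -> theta (v : tangent (hat d' g' s)) = Phi s.
  by apply: cvg_within; exact: PhiE.
near=> s.
have ts : t < s by near: s; exact: nbhs_right_gt.
have se : s < e by near: s; exact: nbhs_right_lt.
have [Is ds Js gs] : [/\ I s, d s = d' s, J s & g s = g' s].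
  by apply: arcE; rewrite !ltW.
have [v1 V1] := smooth_velocity oI sd' Is.
have [v2 V2] := smooth_velocity oJ sg' Js.
have [z Z] := smooth_velocity oIJ shat (conj Is Js).
have nearE : \forall r \near s, d' r = d r /\ g' r = g r.
  have : \forall r \near s, r \in `]t, e[.
    by apply: near_in_itvoo; rewrite in_itv /= ts.
  apply: filterS => r; rewrite in_itv /= => /andP[tr re].
  by have [|_ -> _ ->] := arcE r; rewrite ?ltW.
have V1d : velocity d s v1.
  by apply: velocity_near V1; apply: filterS nearE => r [].
have V2d : velocity g s v2.
  by apply: velocity_near V2; apply: filterS nearE => r [].
have s01 : 0 < s < 1 by move: se; rewrite lt_min => /andP[? ?]; lra.
have F := cartan_form_factor
  (@filterE _ (nbhs s) (nbhs_filter s) _ (hatE d' g')) V1 Z V2.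
have Ad0 : lie_Ad (lie_inv (g' s)) (theta (z : tangent (hat d' g' s))) = 0.
  apply: (addIr (maurer_cartan G (g' s) v2)); rewrite add0r -F.
  rewrite -(form_congr_point _ v1 ds) -(form_congr_point _ v2 gs).
  exact: (dg s v1 v2 s01 V1d V2d).
rewrite -(connection_Ad_eq0 ctheta Z Ad0).
by move: z Z {Ad0 F}; near: s.
Unshelve. all: by end_near. Qed.

(** A horizontal path for the inverse of [a] factors as
    [ext_incl (d s) * g(s)^-1]; being horizontal, it makes [g] the development
    of [d]. No differential equation is solved: the development comes
    with the factorization. *)
Lemma holonomy_sub_intrinsic (u : C) (a : G) :
  holonomy theta (ext_incl E u) a -> intrinsic_holonomy u a.
Proof.
move=> /(holonomy_inv ctheta)[c [pc c0 c1 hc]].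
have [|d [g [pd pg d0 g0 dcg]]] :=
  factorizable_piecewise_smooth pc (u0 := u) (g0 := lie_one G).
  by rewrite c0 pb_act1.
have d1 : ext_incl E (d 1) = pb_act (c 1) (g 1) by apply: dcg; rewrite ler01 /=.
move: d1; rewrite c1 -pb_actM /ext_incl ext_act lie_mul1.
move=> /esym/ext_class_eq[h [d1 ah]].
rewrite lie_mulr1 in ah.
exists d, g, (lie_inv h); split=> //.
- by rewrite d1 pb_actK.
- split=> // t v w t01 vd vg.
  have near01 : \forall s \near t, ext_incl E (d s) = pb_act (c s) (g s).
    have : \forall r \near t, r \in `](0 : R), 1[.
      by apply: near_in_itvoo; rewrite in_itv.
    apply: filterS => r; rewrite in_itv /= => /andP[? ?].
    by apply: dcg; rewrite !ltW.
  have Vj := velocity_comp (ext_incl_smooth_near E (d t)) vd.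
  have Vi := velocity_map (@lie_inv_smooth _ G) vg.
  have [z Z _] := connection_leibniz ctheta Vj Vi.
  have {}Z : velocity c t z.
    apply: velocity_near Z; apply: filterS near01 => s /= ->.
    by rewrite pb_actK.
  rewrite (cartan_form_factor near01 vd Z vg).
  by rewrite (hc t z t01 Z) lie_Ad0 add0r.
- rewrite -(lie_mulK a (g 1)) ah -lie_mulA -sub_inclM lie_mulrV.
  by rewrite sub_incl1 lie_mulr1.
Qed.

End cartan.

Theorem proposition3p2 (R : realType) (K : model_geometry R) (M : manifold R)
  (C : cartan_geometry K M) (E : extended_bundle C)
  (theta : one_form E (lie_algebra (model_group K)))
  (theta_connection : principal_connection theta)
  (theta_extends : forall (u : C) (v : tangent u),
     pullback_form (ext_incl E) theta u v = cartan_form C u v)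
  (u : C) :
  intrinsic_holonomy u = holonomy theta (ext_incl E u).
Proof.
apply/seteqP; split=> a.
  exact: intrinsic_sub_holonomy.
exact: holonomy_sub_intrinsic.
Qed.
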